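(* Let $\tau>0$ and let $J^{m,n}_{p,q}$ be a Fox-Barnes $J$-function with compensation parameter $\varepsilon=0$, parameters $(a_i,\alpha_i)_{1,p}$, $(b_i,\beta_i)_{1,q}$, and suppose that $p=q=m+n$ and $$\alpha_i=\beta_{m+i}\quad(i=1,\dots,n),\qquad \beta_i=\alpha_{n+i}\quad(i=1,\dots,m).$$ Suppose also that there exist integers $m_0,n_0$ with $1\le m_0\le m$ and $1\le n_0\le n$ such that $$a_i=\begin{cases} b_{m+i}-1, & i=1,\dots,n_0,\\ b_{m+i}+1, & i=n_0+1,\dots,n,\end{cases}\qquad b_i=\begin{cases} a_{n+i}+1, & i=1,\dots,m_0,\\ a_{n+i}-1, & i=m_0+1,\dots,m.\end{cases}$$ Then $$J^{m,n}_{p,q}\left[z;\tau\,\Big|\,\begin{matrix}(a_i,\alpha_i)_{1,p}\\(b_i,\beta_i)_{1,q}\end{matrix}\right]=\tau\,H^{m_0,n_0}_{p_0,q_0}\left[z^\tau\,\Big|\,\begin{matrix}(\tilde a_i,\tilde\alpha_i)_{1,p_0}\\(\tilde b_i,\tilde\beta_i)_{1,q_0}\end{matrix}\right],$$ where $p_0=n_0+m-m_0$, $q_0=m_0+n-n_0$ and $$\tilde a_k=\begin{cases}a_k/\tau,&k=1,\dots,n_0,\\(a_{n-n_0+m_0+k}-1)/\tau,&k=n_0+1,\dots,p_0,\end{cases}\qquad \tilde b_k=\begin{cases}(b_k-1)/\tau,&k=1,\dots,m_0,\\ b_{m-m_0+n_0+k}/\tau,&k=m_0+1,\dots,q_0,\end{cases}$$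 $$\tilde\alpha_k=\begin{cases}\alpha_k,&k=1,\dots,n_0,\\ \alpha_{n-n_0+m_0+k},&k=n_0+1,\dots,p_0,\end{cases}\qquad \tilde\beta_k=\begin{cases}\beta_k,&k=1,\dots,m_0,\\ \beta_{m-m_0+n_0+k},&k=m_0+1,\dots,q_0.\end{cases}$$
   Context: **Double gamma function.** For $\tau>0$, $G(\cdot;\tau)$ is the entire function $$G(z;\tau)=\frac{1}{\tau\Gamma(z)}\exp\left[\tilde a(\tau)\frac z\tau+\tilde b(\tau)\frac{z^2}{2\tau^2}\right]\prod_{j=1}^\infty\frac{\Gamma(j\tau)}{\Gamma(z+j\tau)}\exp\left[z\psi(j\tau)+\frac{z^2}{2}\psi'(j\tau)\right],$$ where $\psi=\Gamma'/\Gamma$, $\tilde a(\tau)=\frac\tau2\log(2\pi\tau)+\frac12\log\tau-\tau C(\tau)$, $\tilde b(\tau)=-\tau\log\tau-\tau^2D(\tau)$, $$C(\tau)=\lim_{M\to\infty}\left[\sum_{k=1}^{M-1}\psi(k\tau)+\tfrac12\psi(M\tau)-\tfrac1\tau\log\frac{\Gamma(M\tau)}{\sqrt{2\pi}}\right],\quad D(\tau)=\lim_{M\to\infty}\left[\sum_{k=1}^{M-1}\psi'(k\tau)+\tfrac12\psi'(M\tau)-\tfrac1\tau\psi(M\tau)\right].$$ Its zeros are the points $-j\tau-k$, $j,k=0,1,2,\dots$. **Fox-Barnes $J$-function.** Let $0\le m\le q$, $0\le n\le p$ be integers, $\tau,\alpha_i,\beta_i>0$, $a_i,b_i,\varepsilon\in\mathbb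 C$. Then $$J^{m,n}_{p,q}\left[z;\tau,\varepsilon\,\Big|\,\begin{matrix}(a_i,\alpha_i)_{1,p}\\(b_i,\beta_i)_{1,q}\end{matrix}\right]=\frac1{2\pi i}\int_{\mathcal C}\mathcal J(s)\,e^{\pi\varepsilon s^2/\tau}z^{-s}\,ds,$$ $$\mathcal J(s)=\frac{\prod_{i=1}^mG(b_i+\beta_is;\tau)\prod_{i=1}^nG(1+\tau-a_i-\alpha_is;\tau)}{\prod_{i=m+1}^qG(1+\tau-b_i-\beta_is;\tau)\prod_{i=n+1}^pG(a_i+\alpha_is;\tau)}.$$ Here $(a_i,\alpha_i)_{1,p}$ is the ordered list $(a_1,\alpha_1),\dots,(a_p,\alpha_p)$ (similarly for the $b$'s); when $\varepsilon$ is omitted from the notation, $\varepsilon=0$. The contour $\mathcal C$ separates the poles of $\mathcal J$ arising from zeros of $G(a_i+\alpha_is;\tau)$, $n+1\le i\le p$ (these lie to its left), from the poles arising from zeros of $G(1+\tau-b_i-\beta_is;\tau)$, $m+1\le i\le q$ (these lie to its right). It is one of: the vertical line $\mathcal C_{ic\infty}$ from $c-i\infty$ to $c+i\infty$; a left loop $\mathcal C_{-\infty}$ from $-\infty+i\varphi_1$ to $-\infty+i\varphi_2$, or a right loop $\mathcal C_{+\infty}$ from $+\infty+i\varphi_1$ to $+\infty+i\varphi_2$, contained in a horizontal strip, $\varphi_1<0<\varphi_2$; or more generally a contour starting with a half-line in the lower half-plane and ending with a half-line in the upper half-plane. Standing assumptions: the left and right families of zeros do not meet, and $\mathcal A<\mathcal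 B$, where $\mathcal A=-\min_{n+1\le i\le p}\operatorname{Re}a_i/\alpha_i$, $\mathcal B=\min_{m+1\le i\le q}(1+\tau-\operatorname{Re}b_i)/\beta_i$. **Fox $H$-function.** $$H^{m,n}_{p,q}\left[z\,\Big|\,\begin{matrix}(a_i,\alpha_i)_{1,p}\\(b_i,\beta_i)_{1,q}\end{matrix}\right]=\frac1{2\pi i}\int_\gamma\frac{\prod_{i=1}^m\Gamma(b_i+\beta_is)\prod_{i=1}^n\Gamma(1-a_i-\alpha_is)}{\prod_{i=m+1}^q\Gamma(1-b_i-\beta_is)\prod_{i=n+1}^p\Gamma(a_i+\alpha_is)}z^{-s}\,ds,$$ with $\gamma$ either a vertical line from $c-i\infty$ to $c+i\infty$, or a left loop from $-\infty+i\varphi_1$ to $-\infty+i\varphi_2$ or a right loop from $+\infty+i\varphi_1$ to $+\infty+i\varphi_2$ contained in a horizontal strip ($\varphi_1<0<\varphi_2$), or more generally a contour starting with a half-line in the lower half-plane and ending with a half-line in the upper half-plane, with the poles of the $\Gamma(b_i+\beta_is)$ on its left and those of the $\Gamma(1-a_i-\alpha_is)$ on its right. **Conventions.** $z\ne0$, $z^{w}=\exp(w(\log|z|+i\arg z))$ for a fixed choice of $\arg z$, and $\arg(z^\tau)=\tau\arg z$. The identity is understood for those $z$ and $\mathcal C$ for which the integral defining $J$ converges; the $H$-function is taken along $\gamma=\tau^{-1}\mathcal C$, which is of the same type as $\mathcal C$. *)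

(* Defs.v *)
(* Stdlib real numbers with Coquelicot: complex numbers, limits, improper
   Riemann integrals. *)
From Stdlib Require Import List Factorial.
From Stdlib Require Export Reals.
From Coquelicot Require Export Coquelicot.

Open Scope R_scope.

(* Coquelicot's [C] has no exponential. *)
Definition Cexp (w : C) : C := (exp (Re w) * cos (Im w), exp (Re w) * sin (Im w)).

Definition is_arg (z : C) (theta : R) : Prop := z = (Cmod z * Cexp (Ci * theta))%C.

(* z^w for the determination [theta] of arg z: a point of the Riemann surface
   of the logarithm is a pair (z, theta) with [is_arg z theta]. *)
Definition cpow_arg (z : C) (theta : R) (w : C) : C :=
  Cexp (w * (ln (Cmod z) + Ci * theta)).

(* Limit of a complex sequence; meaningful when both components converge. *)
Definition Clim_seq (u : nat -> C) : C :=
  (real (Lim_seq (fun n => Re (u n))), real (Lim_seq (fun n => Im (u n)))).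

(* f lo * ... * f hi, equal to 1 when hi < lo. *)
Definition cprod (f : nat -> C) (lo hi : nat) : C :=
  Iter.iter_nat Cmult (RtoC 1) f lo hi.

(* The entire function 1/Gamma, by Euler's limit
   Gamma(z) = lim N! N^z / (z (z+1) ... (z+N)); the poles of Gamma are the
   zeros of [RGamma]. *)
Definition RGamma (z : C) : C :=
  Clim_seq (fun N =>
    (Cexp (- z * ln (INR N)) * cprod (fun k => (z + INR k)%C) 0 N / INR (fact N))%C).

Definition Gamma (z : C) : C := (/ RGamma z)%C.

Definition GammaR (x : R) : R := Re (Gamma x).
Definition digamma (x : R) : R := Derive GammaR x / GammaR x.
Definition trigamma (x : R) : R := Derive digamma x.

Definition dG_C (tau : R) : R :=
  real (Lim_seq (fun M =>
    sum_n_m (fun k => digamma (INR k * tau)) 1 (M - 1)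
    + / 2 * digamma (INR M * tau)
    - / tau * ln (GammaR (INR M * tau) / sqrt (2 * PI)))).

Definition dG_D (tau : R) : R :=
  real (Lim_seq (fun M =>
    sum_n_m (fun k => trigamma (INR k * tau)) 1 (M - 1)
    + / 2 * trigamma (INR M * tau)
    - / tau * digamma (INR M * tau))).

Definition dG_a (tau : R) : R :=
  tau / 2 * ln (2 * PI * tau) + / 2 * ln tau - tau * dG_C tau.

Definition dG_b (tau : R) : R := - tau * ln tau - tau ^ 2 * dG_D tau.

(* The double gamma function G(z; tau). The factors 1/Gamma(z) and
   1/Gamma(z + j tau) are written with [RGamma], so that they vanish at the
   poles of Gamma. *)
Definition dG (tau : R) (z : C) : C :=
  (/ tau * RGamma z
   * Cexp (dG_a tau * (z / tau) + dG_b tau * (z ^ 2 / (2 * tau ^ 2)))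
   * Clim_seq (fun N =>
       cprod (fun j =>
         GammaR (INR j * tau)%R * RGamma (z + INR j * tau)
         * Cexp (z * digamma (INR j * tau)%R
                 + z ^ 2 / 2 * trigamma (INR j * tau)%R)) 1 N))%C.

(* A contour is a parametrised path gamma : R -> C; its two ends correspond to
   t -> -oo and t -> +oo. *)
Definition path_deriv (g : R -> C) (t : R) : C :=
  (Derive (fun u => Re (g u)) t, Derive (fun u => Im (g u)) t).

Definition piecewise_C1 (g : R -> C) : Prop :=
  (forall t, continuous g t) /\
  exists breaks : list R,
    (forall t, ~ In t breaks ->
       ex_derive (fun u => Re (g u)) t /\ ex_derive (fun u => Im (g u)) t /\
       continuous (path_deriv g) t) /\
    (forall t, In t breaks ->
       (exists d : C, filterlim (path_deriv g) (at_left t) (locally d)) /\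
       (exists d : C, filterlim (path_deriv g) (at_right t) (locally d))).

Inductive contour_kind : Set :=
  vertical_line | left_loop | right_loop | half_line_ends.

(* A loop starting at e + i phi1 and ending at e + i phi2 with e = -oo or +oo. *)
Definition is_loop (e : Rbar) (g : R -> C) : Prop :=
  exists phi1 phi2 : R, phi1 < 0 < phi2 /\
    is_lim (fun t => Re (g t)) m_infty e /\ is_lim (fun t => Im (g t)) m_infty phi1 /\
    is_lim (fun t => Re (g t)) p_infty e /\ is_lim (fun t => Im (g t)) p_infty phi2 /\
    exists h1 h2 : R, forall t, h1 <= Im (g t) <= h2.

Definition has_kind (k : contour_kind) (g : R -> C) : Prop :=
  match k with
  | vertical_line =>
      (exists c : R, forall t, Re (g t) = c) /\
      (forall t u, t < u -> Im (g t) < Im (g u)) /\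
      is_lim (fun t => Im (g t)) m_infty m_infty /\
      is_lim (fun t => Im (g t)) p_infty p_infty
  | left_loop => is_loop m_infty g
  | right_loop => is_loop p_infty g
  | half_line_ends =>
      exists (t0 t1 : R) (u v : C), t0 <= t1 /\ u <> RtoC 0 /\ v <> RtoC 0 /\
        (forall t, t <= t0 -> g t = (g t0 + (t - t0) * u)%C /\ Im (g t) < 0) /\
        (forall t, t1 <= t -> g t = (g t1 + (t - t1) * v)%C /\ 0 < Im (g t))
  end.

Definition contour (k : contour_kind) (g : R -> C) : Prop :=
  piecewise_C1 g /\ has_kind k g.

(* w and w' lie in the same connected component of the complement of g. *)
Definition same_side (g : R -> C) (w w' : C) : Prop :=
  exists h : R -> C,
    (forall x, continuous h x) /\ h 0 = w /\ h 1 = w' /\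
    forall x t, 0 <= x <= 1 -> h x <> g t.

(* A contour of any of the four kinds comes from below and leaves upwards, and
   misses the real axis far from the origin. So its left side is the component
   of its complement that contains the far negative real half-axis, and its
   right side the one that contains the far positive real half-axis. *)
Definition left_of (g : R -> C) (w : C) : Prop :=
  exists M : R, forall x : R, x <= M -> same_side g w x.
Definition right_of (g : R -> C) (w : C) : Prop :=
  exists M : R, forall x : R, M <= x -> same_side g w x.

Definition separates (g : R -> C) (L Rt : C -> Prop) : Prop :=
  (forall s, L s -> left_of g s) /\ (forall s, Rt s -> right_of g s).

(* The integral is improper at both ends, independently (no principal value). *)
Definition pullback (f : C -> C) (g : R -> C) (t : R) : C :=
  (f (g t) * path_deriv g t)%C.

Definition contour_converges (f : C -> C) (g : R -> C) : Prop :=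
  ex_RInt_gen (V := C_R_NormedModule) (pullback f g)
    (Rbar_locally m_infty) (Rbar_locally p_infty).

Definition contour_int (f : C -> C) (g : R -> C) : C :=
  RInt_gen (V := C_R_CompleteNormedModule) (pullback f g)
    (Rbar_locally m_infty) (Rbar_locally p_infty).

(* Parameter lists (a_i, alpha_i)_{1,p} are functions on nat of which only the
   values at 1, ..., p are used. *)
Definition J_integrand (tau : R) (m n p q : nat)
    (a : nat -> C) (alpha : nat -> R) (b : nat -> C) (beta : nat -> R) (s : C) : C :=
  (cprod (fun i => dG tau (b i + beta i * s)) 1 m
   * cprod (fun i => dG tau (1 + tau - a i - alpha i * s)) 1 n
   / (cprod (fun i => dG tau (1 + tau - b i - beta i * s)) (m + 1) q
      * cprod (fun i => dG tau (a i + alpha i * s)) (n + 1) p))%C.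

Definition J_full_integrand (tau : R) (eps : C) (m n p q : nat)
    (a : nat -> C) (alpha : nat -> R) (b : nat -> C) (beta : nat -> R)
    (z : C) (theta : R) (s : C) : C :=
  (J_integrand tau m n p q a alpha b beta s
   * Cexp (PI * eps * s ^ 2 / tau) * cpow_arg z theta (- s))%C.

Definition foxJ (tau : R) (eps : C) (m n p q : nat)
    (a : nat -> C) (alpha : nat -> R) (b : nat -> C) (beta : nat -> R)
    (z : C) (theta : R) (g : R -> C) : C :=
  (/ (2 * PI * Ci)
   * contour_int (J_full_integrand tau eps m n p q a alpha b beta z theta) g)%C.

Definition J_left_pole (tau : R) (n p : nat) (a : nat -> C) (alpha : nat -> R)
    (s : C) : Prop :=
  exists i : nat, (n + 1 <= i <= p)%nat /\ dG tau (a i + alpha i * s)%C = RtoC 0.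

Definition J_right_pole (tau : R) (m q : nat) (b : nat -> C) (beta : nat -> R)
    (s : C) : Prop :=
  exists i : nat, (m + 1 <= i <= q)%nat /\
    dG tau (1 + tau - b i - beta i * s)%C = RtoC 0.

(* The minima are infima in Rbar: a minimum over an empty range is +oo. *)
Definition J_A (n p : nat) (a : nat -> C) (alpha : nat -> R) : Rbar :=
  Rbar_opp (Glb_Rbar (fun x : R =>
    exists i : nat, (n + 1 <= i <= p)%nat /\ x = Re (a i) / alpha i)).

Definition J_B (tau : R) (m q : nat) (b : nat -> C) (beta : nat -> R) : Rbar :=
  Glb_Rbar (fun x : R =>
    exists i : nat, (m + 1 <= i <= q)%nat /\ x = (1 + tau - Re (b i)) / beta i).

Record foxJ_defined (tau : R) (eps : C) (m n p q : nat)
    (a : nat -> C) (alpha : nat -> R) (b : nat -> C) (beta : nat -> R)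
    (z : C) (theta : R) (k : contour_kind) (g : R -> C) : Prop := {
  J_m_le_q : (m <= q)%nat;
  J_n_le_p : (n <= p)%nat;
  J_tau_pos : 0 < tau;
  J_alpha_pos : forall i : nat, (1 <= i <= p)%nat -> 0 < alpha i;
  J_beta_pos : forall i : nat, (1 <= i <= q)%nat -> 0 < beta i;
  J_disjoint : forall s : C,
    ~ (J_left_pole tau n p a alpha s /\ J_right_pole tau m q b beta s);
  J_A_lt_B : Rbar_lt (J_A n p a alpha) (J_B tau m q b beta);
  J_z_neq0 : z <> RtoC 0;
  J_arg : is_arg z theta;
  J_contour : contour k g;
  J_separates : separates g (J_left_pole tau n p a alpha) (J_right_pole tau m q b beta);
  J_converges :
    contour_converges (J_full_integrand tau eps m n p q a alpha b beta z theta) g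
}.

(* At a pole of a Gamma factor of the denominator this is 0, as it should be:
   Gamma = / 0 = 0 there, and the inverse of 0 in [C] is 0. *)
Definition H_integrand (m n p q : nat)
    (a : nat -> C) (alpha : nat -> R) (b : nat -> C) (beta : nat -> R)
    (z : C) (theta : R) (s : C) : C :=
  (cprod (fun i => Gamma (b i + beta i * s)) 1 m
   * cprod (fun i => Gamma (1 - a i - alpha i * s)) 1 n
   / (cprod (fun i => Gamma (1 - b i - beta i * s)) (m + 1) q
      * cprod (fun i => Gamma (a i + alpha i * s)) (n + 1) p)
   * cpow_arg z theta (- s))%C.

Definition foxH (m n p q : nat)
    (a : nat -> C) (alpha : nat -> R) (b : nat -> C) (beta : nat -> R)
    (z : C) (theta : R) (g : R -> C) : C :=
  (/ (2 * PI * Ci)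
   * contour_int (H_integrand m n p q a alpha b beta z theta) g)%C.

Definition H_left_pole (m : nat) (b : nat -> C) (beta : nat -> R) (s : C) : Prop :=
  exists i : nat, (1 <= i <= m)%nat /\ RGamma (b i + beta i * s)%C = RtoC 0.

Definition H_right_pole (n : nat) (a : nat -> C) (alpha : nat -> R) (s : C) : Prop :=
  exists i : nat, (1 <= i <= n)%nat /\ RGamma (1 - a i - alpha i * s)%C = RtoC 0.

Record foxH_defined (m n p q : nat)
    (a : nat -> C) (alpha : nat -> R) (b : nat -> C) (beta : nat -> R)
    (z : C) (theta : R) (k : contour_kind) (g : R -> C) : Prop := {
  H_m_le_q : (m <= q)%nat;
  H_n_le_p : (n <= p)%nat;
  H_alpha_pos : forall i : nat, (1 <= i <= p)%nat -> 0 < alpha i;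
  H_beta_pos : forall i : nat, (1 <= i <= q)%nat -> 0 < beta i;
  H_z_neq0 : z <> RtoC 0;
  H_arg : is_arg z theta;
  H_contour : contour k g;
  H_separates : separates g (H_left_pole m b beta) (H_right_pole n a alpha);
  H_converges :
    contour_converges (H_integrand m n p q a alpha b beta z theta) g
}.

(* Main.v *)
Require Import Defs.
From Stdlib Require Import Psatz Lia Factorial.

(** Everything rests on the functional equation of the double gamma function,
    in the division-free form
      G(z; tau) = (1/Gamma)(z/tau) G(z + 1; tau)      for every complex z
    ([dG_shift]). The hypotheses pair the factors of the integrand of J:
    each numerator factor is G(w + 1) or G(w - 1) where G(w) is a factor of the
    denominator, so that every quotient collapses to Gamma(w/tau) or to
    1/Gamma((w - 1)/tau), and no double gamma function is left. The result is
    the integrand of H at s/tau, and the substitution s -> s/tau produces the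
    factor tau. The quotients may be simplified because a separating contour
    cannot meet the zeros that it separates; and where 1/Gamma(w/tau) vanishes
    the functional equation shows that G(w) vanishes too, so that the poles of
    H, rescaled, are among the poles of J.

    For the functional equation, compare the N-th partial products of G(z) and
    of G(z + 1). By Gamma(w + 1) = w Gamma(w) their quotient is a product of
    linear factors z + j tau, which is the N-th term of Euler's limit for
    (1/Gamma)(z/tau), times an exponential. The exponent tends to 0 by the
    choice of the constants a(tau) and b(tau) ([dG_a_eq], [dG_b_eq]). This asks
    for three analytic facts.

    - Convergence. With E2 the Weierstrass factor (1 + u) exp(-u + u^2/2), the
      terms of Euler's limits satisfy
        RGamma_N(x + z)/RGamma_N(x)
          = exp(-z psi_N(x) - z^2/2 psi'_N(x)) prod_(k <= N) E2(z/(x + k)),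
      where psi_N and psi'_N are the partial sums of the classical series for
      the digamma and trigamma functions. Since |E2(u) - 1| = O(|u|^3)
      ([E2_sub_1]), this gives at once the convergence of Euler's limit for
      every complex argument ([RGamma_spec]) and, read at x = j tau, that the
      j-th factor of G is 1 + O(1/j^2) ([weierstrass_spec]).
    - Asymptotics. The trapezoid rule for the logarithm gives
      psi(x) = ln x - 1/(2x) + O(1/x^2), and similarly psi'(x) = 1/x + O(1/x^2).
      Hence the sums over the multiples of tau have asymptotic expansions, and
      the limits C(tau) and D(tau) exist.
    - Stirling's formula with its constant ln(2 pi)/2, which enters through
      C(tau). The existence of a constant follows from the expansion of psi, its
      value from the Wallis integrals ([binet_spec]).

    Convergence of sequences is nearly always obtained by telescoping
    ([telescoping_cv]): the increments are bounded by those of a nonnegative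
    sequence, which also bounds the distance to the limit. *)

(** * Complex exponential, limits and products *)

Lemma C_eq (x y : C) : Re x = Re y -> Im x = Im y -> x = y.
Proof. destruct x, y; simpl; intros; subst; reflexivity. Qed.

Lemma Cexp_plus (x y : C) : Cexp (x + y) = (Cexp x * Cexp y)%C.
Proof.
  destruct x as [x1 x2], y as [y1 y2]; apply C_eq; unfold Cexp; simpl;
  rewrite exp_plus, ?cos_plus, ?sin_plus; ring.
Qed.

Lemma Cexp_RtoC (x : R) : Cexp x = RtoC (exp x).
Proof. apply C_eq; unfold Cexp; simpl; rewrite ?cos_0, ?sin_0; ring. Qed.

Lemma Cexp_0 : Cexp 0 = RtoC 1.
Proof. rewrite Cexp_RtoC, exp_0; reflexivity. Qed.

Lemma Cmod_Cexp (x : C) : Cmod (Cexp x) = exp (Re x).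
Proof.
  unfold Cmod, Cexp; simpl.
  replace (_ + _) with (exp (Re x) * exp (Re x)).
  - apply sqrt_square; apply Rlt_le, exp_pos.
  - pose proof (sin2_cos2 (Im x)); unfold Rsqr in *.
    transitivity (exp (Re x) * exp (Re x) * (sin (Im x) * sin (Im x) + cos (Im x) * cos (Im x))).
    + rewrite H; ring.
    + ring.
Qed.

Lemma Cexp_neq_0 (x : C) : Cexp x <> 0.
Proof. apply Cmod_gt_0; rewrite Cmod_Cexp; apply exp_pos. Qed.

Lemma Cexp_ln (r : R) : 0 < r -> Cexp (ln r) = RtoC r.
Proof. intros; rewrite Cexp_RtoC, exp_ln; auto. Qed.

Lemma im_le_Cmod (c : C) : Rabs (Im c) <= Cmod c.
Proof. eapply Rle_trans; [|apply Rmax_Cmod]; apply Rmax_r. Qed.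

Lemma Cmod_le_add (c : C) : Cmod c <= Rabs (Re c) + Rabs (Im c).
Proof.
  unfold Cmod; rewrite <- (sqrt_square (Rabs (Re c) + Rabs (Im c))).
  2: { pose proof (Rabs_pos (Re c)); pose proof (Rabs_pos (Im c)); lra. }
  apply sqrt_le_1_alt. unfold Re, Im.
  pose proof (Rabs_pos (fst c)); pose proof (Rabs_pos (snd c)).
  rewrite <- (pow2_abs (fst c)), <- (pow2_abs (snd c)); nra.
Qed.

(** Coordinatewise convergence, the notion under which [Clim_seq] computes the
    limit. *)
Definition is_Clim (u : nat -> C) (l : C) : Prop :=
  is_lim_seq (fun n => Re (u n)) (Re l) /\ is_lim_seq (fun n => Im (u n)) (Im l).

Lemma is_Clim_unique (u : nat -> C) (l : C) : is_Clim u l -> Clim_seq u = l.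
Proof.
  intros [H1 H2]; apply C_eq; unfold Clim_seq; simpl.
  - now rewrite (is_lim_seq_unique _ _ H1).
  - now rewrite (is_lim_seq_unique _ _ H2).
Qed.

Lemma is_Clim_ext_loc (u v : nat -> C) (l : C) :
  eventually (fun n => u n = v n) -> is_Clim u l -> is_Clim v l.
Proof.
  intros [N HN] [H1 H2]; split; eapply is_lim_seq_ext_loc; try eassumption;
  exists N; intros n Hn; now rewrite HN.
Qed.

Lemma is_Clim_ext (u v : nat -> C) (l : C) :
  (forall n, u n = v n) -> is_Clim u l -> is_Clim v l.
Proof. intros H; apply is_Clim_ext_loc; exists 0%nat; auto. Qed.

Lemma is_Clim_const (c : C) : is_Clim (fun _ => c) c.
Proof. split; apply is_lim_seq_const. Qed.

Lemma is_Clim_RtoC (u : nat -> R) (l : R) :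
  is_lim_seq u l -> is_Clim (fun n => RtoC (u n)) l.
Proof. split; simpl; [assumption|apply is_lim_seq_const]. Qed.

Lemma is_Clim_plus (u v : nat -> C) (l l' : C) :
  is_Clim u l -> is_Clim v l' -> is_Clim (fun n => u n + v n)%C (l + l')%C.
Proof.
  intros [H1 H2] [H3 H4]; split; simpl; apply (is_lim_seq_plus' _ _ _ _); assumption.
Qed.

Lemma is_Clim_mult (u v : nat -> C) (l l' : C) :
  is_Clim u l -> is_Clim v l' -> is_Clim (fun n => u n * v n)%C (l * l')%C.
Proof.
  intros [H1 H2] [H3 H4]; split; simpl.
  - apply (is_lim_seq_minus' _ _ _ _); apply (is_lim_seq_mult' _ _ _ _); assumption.
  - apply (is_lim_seq_plus' _ _ _ _); apply (is_lim_seq_mult' _ _ _ _); assumption.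
Qed.

Lemma is_Clim_exp (u : nat -> C) (l : C) :
  is_Clim u l -> is_Clim (fun n => Cexp (u n)) (Cexp l).
Proof.
  intros [H1 H2]; split; unfold Cexp; simpl; apply (is_lim_seq_mult' _ _ _ _).
  1,3: apply (is_lim_seq_continuous exp (fun n => Re (u n)));
     [apply derivable_continuous_pt, derivable_pt_exp|assumption].
  - apply (is_lim_seq_continuous cos (fun n => Im (u n)));
     [apply derivable_continuous_pt, derivable_pt_cos|assumption].
  - apply (is_lim_seq_continuous sin (fun n => Im (u n)));
     [apply derivable_continuous_pt, derivable_pt_sin|assumption].
Qed.

(** The sequences u - B and u + B are monotone and bracket the limit. This
    gives convergence together with an error bound, without series. *)
Lemma telescoping_cv (u B : nat -> R) :
  (forall n, Rabs (u (S n) - u n) <= B n - B (S n)) -> (forall n, 0 <= B n) ->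
  exists l : R, is_lim_seq u l /\ forall n, Rabs (l - u n) <= B n.
Proof.
  intros Hu HB.
  assert (Hd : forall n, B (S n) <= B n).
  { intros n; specialize (Hu n); pose proof (Rabs_pos (u (S n) - u n)); lra. }
  assert (Hm : forall n, u n - B n <= u (S n) - B (S n) /\ u (S n) + B (S n) <= u n + B n).
  { intros n; specialize (Hu n). apply Rabs_le_between in Hu; lra. }
  assert (Hub : forall n, u n + B n <= u 0%nat + B 0%nat).
  { induction n; [lra|]. specialize (Hm n); lra. }
  destruct (ex_finite_lim_seq_incr (fun n => u n - B n) (u 0%nat + B 0%nat)) as [l1 Hl1].
  { intros n; apply Hm. }
  { intros n; specialize (Hub n); specialize (HB n); lra. }
  destruct (ex_finite_lim_seq_decr B 0 Hd HB) as [l2 Hl2].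
  assert (Hl : is_lim_seq u (l1 + l2)).
  { apply is_lim_seq_ext with (fun n => (u n - B n) + B n); [intros; ring|].
    apply (is_lim_seq_plus' _ _ _ _); assumption. }
  exists (l1 + l2); split; [assumption|].
  intros n.
  assert (Hk : forall k, u n - B n <= u (k + n)%nat <= u n + B n).
  { intros k.
    assert (u n - B n <= u (k + n)%nat - B (k + n)%nat /\
            u (k + n)%nat + B (k + n)%nat <= u n + B n).
    { induction k; simpl; [split; lra|]. specialize (Hm (k + n)%nat); split; lra. }
    specialize (HB (k + n)%nat); split; lra. }
  apply (is_lim_seq_incr_n _ n) in Hl.
  assert (u n - B n <= l1 + l2).
  { apply (is_lim_seq_le (fun _ => u n - B n) (fun k => u (k + n)%nat) (Finite (u n - B n)) (Finite (l1 + l2)));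
      [apply Hk|apply is_lim_seq_const|assumption]. }
  assert (l1 + l2 <= u n + B n).
  { apply (is_lim_seq_le (fun k => u (k + n)%nat) (fun _ => u n + B n) (Finite (l1 + l2)) (Finite (u n + B n)));
      [apply Hk|assumption|apply is_lim_seq_const]. }
  apply Rabs_le_between; lra.
Qed.

Lemma telescoping_Ccv (u : nat -> C) (B : nat -> R) :
  (forall n, Cmod (u (S n) - u n)%C <= B n - B (S n)) -> (forall n, 0 <= B n) ->
  exists l : C, is_Clim u l /\ forall n, Cmod (l - u n)%C <= 2 * B n.
Proof.
  intros Hu HB.
  destruct (telescoping_cv (fun n => Re (u n)) B) as [l1 [H1 H1']]; auto.
  { intros n; eapply Rle_trans; [|apply Hu].
    eapply Rle_trans; [|apply re_le_Cmod]; apply Req_le; reflexivity. }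
  destruct (telescoping_cv (fun n => Im (u n)) B) as [l2 [H2 H2']]; auto.
  { intros n; eapply Rle_trans; [|apply Hu].
    eapply Rle_trans; [|apply im_le_Cmod]; apply Req_le; reflexivity. }
  exists (l1, l2); split; [split; assumption|].
  intros n; eapply Rle_trans; [apply Cmod_le_add|].
  specialize (H1' n); specialize (H2' n).
  change (Rabs (l1 - Re (u n)) + Rabs (l2 - Im (u n)) <= 2 * B n); lra.
Qed.

Lemma cprod_S (f : nat -> C) (lo n : nat) : (lo <= S n)%nat ->
  cprod f lo (S n) = (cprod f lo n * f (S n))%C.
Proof.
  intros H; unfold cprod.
  rewrite (Iter.iter_nat_Chasles Cmult (RtoC 1) Cmult_1_l Cmult_assoc f lo n (S n)) by lia.
  rewrite (Iter.iter_nat_point Cmult (RtoC 1) Cmult_1_r); reflexivity.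
Qed.

Lemma cprod_empty (f : nat -> C) (lo hi : nat) : (hi < lo)%nat -> cprod f lo hi = RtoC 1.
Proof.
  intros H; unfold cprod, Iter.iter_nat.
  replace (S hi - lo)%nat with 0%nat by lia; reflexivity.
Qed.

Lemma cprod_point (f : nat -> C) (n : nat) : cprod f n n = f n.
Proof. apply Iter.iter_nat_point, Cmult_1_r. Qed.

Lemma cprod_ext (f g : nat -> C) (lo hi : nat) :
  (forall k, (lo <= k <= hi)%nat -> f k = g k) -> cprod f lo hi = cprod g lo hi.
Proof. apply Iter.iter_nat_ext_loc. Qed.

Lemma cprod_split (f : nat -> C) (lo mid hi : nat) : (lo <= S mid)%nat -> (mid <= hi)%nat ->
  cprod f lo hi = (cprod f lo mid * cprod f (S mid) hi)%C.
Proof. apply (Iter.iter_nat_Chasles Cmult (RtoC 1) Cmult_1_l Cmult_assoc). Qed.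

Lemma cprod_mult (f g : nat -> C) (lo hi : nat) :
  cprod (fun k => f k * g k)%C lo hi = (cprod f lo hi * cprod g lo hi)%C.
Proof.
  induction hi as [|hi IH].
  - destruct lo as [|lo]; [rewrite !cprod_point; reflexivity|].
    rewrite !cprod_empty by lia; ring.
  - destruct (Nat.le_gt_cases lo (S hi)).
    + rewrite !cprod_S, IH by lia; ring.
    + rewrite !cprod_empty by lia; ring.
Qed.

Lemma cprod_shift (d : nat) : forall (f : nat -> C) (lo hi : nat),
  cprod f (d + lo) (d + hi) = cprod (fun k => f (d + k)%nat) lo hi.
Proof.
  induction d as [|d IH]; intros; [reflexivity|]. simpl.
  unfold cprod in *. rewrite <- Iter.iter_nat_S. apply (IH (fun n => f (S n))).
Qed.

Lemma Cinv_0 : (/ 0)%C = 0.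
Proof. apply C_eq; unfold Cinv; simpl; unfold Rdiv; ring. Qed.

(** The inverse of 0 is 0, so the law also covers the Gamma factors of H that
    take the value 0 at a pole. *)
Lemma Cinv_mult_total (x y : C) : (/ (x * y) = / x * / y)%C.
Proof.
  destruct (Ceq_dec x 0) as [->|Hx]; [rewrite Cmult_0_l, Cinv_0; ring|].
  destruct (Ceq_dec y 0) as [->|Hy]; [rewrite Cmult_0_r, Cinv_0; ring|].
  field; auto.
Qed.

Lemma Cinv_inv_total (x : C) : (/ / x = x)%C.
Proof.
  destruct (Ceq_dec x 0) as [->|Hx]; [now rewrite !Cinv_0|].
  field; auto.
Qed.

Lemma cprod_inv (f : nat -> C) (lo hi : nat) :
  (/ cprod f lo hi = cprod (fun k => / f k) lo hi)%C.
Proof.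
  induction hi as [|hi IH].
  - destruct lo as [|lo]; [rewrite !cprod_point; reflexivity|].
    rewrite !cprod_empty by lia. field; intros E; apply RtoC_inj in E; lra.
  - destruct (Nat.le_gt_cases lo (S hi)).
    + rewrite !cprod_S, <- IH by lia; apply Cinv_mult_total.
    + rewrite !cprod_empty by lia. field; intros E; apply RtoC_inj in E; lra.
Qed.

(** The partial products are bounded by exp(B 0), because |f| <= 1 + |f - 1|
    <= exp |f - 1|; so their increments are at most exp(B 0) times those of B. *)
Lemma cprod_cv (f : nat -> C) (B : nat -> R) :
  (forall n, Cmod (f (S n) - 1)%C <= B n - B (S n)) -> (forall n, 0 <= B n) ->
  exists l : C, is_Clim (cprod f 1) l /\ Cmod (l - 1)%C <= 2 * (exp (B 0%nat) * B 0%nat).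
Proof.
  intros Hf HB.
  assert (Hd : forall n, 0 <= B n - B (S n)).
  { intros n; eapply Rle_trans; [apply Cmod_ge_0|apply Hf]. }
  assert (Hb : forall n, Cmod (cprod f 1 n) <= exp (B 0%nat - B n)).
  { induction n as [|n IH].
    - rewrite cprod_empty, Cmod_1 by lia. rewrite Rminus_eq_0, exp_0; lra.
    - rewrite cprod_S, Cmod_mult by lia.
      replace (B 0%nat - B (S n)) with ((B 0%nat - B n) + (B n - B (S n))) by ring.
      rewrite exp_plus. apply Rmult_le_compat; try apply Cmod_ge_0; auto.
      eapply Rle_trans; [|apply exp_ineq1_le].
      replace (f (S n)) with (1 + (f (S n) - 1))%C by ring.
      eapply Rle_trans; [apply Cmod_triangle|].
      rewrite Cmod_1; specialize (Hf n); lra. }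
  destruct (telescoping_Ccv (cprod f 1) (fun n => exp (B 0%nat) * B n)) as [l [Hl Hl']].
  - intros n. rewrite cprod_S by lia.
    replace (cprod f 1 n * f (S n) - cprod f 1 n)%C
      with (cprod f 1 n * (f (S n) - 1))%C by ring.
    rewrite Cmod_mult, <- Rmult_minus_distr_l.
    apply Rmult_le_compat; try apply Cmod_ge_0; auto.
    eapply Rle_trans; [apply Hb|].
    specialize (HB n). destruct (Req_dec (B n) 0) as [->|Hn].
    + rewrite Rminus_0_r; lra.
    + apply Rlt_le, exp_increasing; lra.
  - intros n; apply Rmult_le_pos; auto; apply Rlt_le, exp_pos.
  - exists l; split; auto. specialize (Hl' 0%nat).
    rewrite cprod_empty in Hl' by lia. exact Hl'.
Qed.

Lemma cprod_cv_0 (f : nat -> C) (B : nat -> R) :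
  (forall n, Cmod (f n - 1)%C <= B n - B (S n)) -> (forall n, 0 <= B n) ->
  exists l : C, is_Clim (cprod f 0) l /\ Cmod (l - 1)%C <= 2 * (exp (B 0%nat) * B 0%nat).
Proof.
  intros Hf HB. destruct (cprod_cv (fun k => f (pred k)) B) as [l [[H1 H2] H]]; auto.
  exists l; split; auto.
  assert (E : forall N, cprod (fun k => f (pred k)) 1 (S N) = cprod f 0 N)
    by exact (cprod_shift 1 (fun k => f (pred k)) 0).
  apply is_lim_seq_incr_1 in H1; apply is_lim_seq_incr_1 in H2.
  split; (eapply is_lim_seq_ext; [intros n; rewrite <- E; reflexivity|assumption]).
Qed.

(** The Weierstrass elementary factor of genus 2, at - u. *)
Definition E2 (u : C) : C := ((1 + u) * Cexp (- u + u ^ 2 / 2))%C.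

(** Along the segment from 0 to u, the derivative of s -> E2(su) is s^2 u^3
    exp(-su + s^2 u^2/2): the terms of lower order cancel. The mean value
    theorem is applied to the real and imaginary parts separately, whence the
    factor 2. *)
Lemma E2_sub_1 (u : C) : Cmod (E2 u - 1)%C <= 2 * (Cmod u ^ 3 * exp (Cmod u + Cmod u ^ 2)).
Proof.
  destruct u as [x y].
  assert (HE : E2 (x, y) =
    ((1 + (x, y)) * Cexp (- x + (x * x - y * y) / 2, - y + x * y)%R)%C).
  { unfold E2. do 2 f_equal.
    replace ((x, y) ^ 2 / 2)%C with (RtoC (/ 2) * ((x, y) * (x, y)))%C
      by (rewrite RtoC_inv by lra; unfold Cdiv; ring).
    apply C_eq; simpl; field. }
  set (a := fun s => - s * x + s * s * (x * x - y * y) / 2).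
  set (b := fun s => - s * y + s * s * (x * y)).
  set (fr := fun s => exp (a s) * ((1 + s * x) * cos (b s) - s * y * sin (b s))).
  set (fi := fun s => exp (a s) * ((1 + s * x) * sin (b s) + s * y * cos (b s))).
  set (d := fun s => (RtoC (s * s) * ((x, y) * ((x, y) * (x, y))) * Cexp (a s, b s))%C).
  set (M := Cmod (x, y) ^ 3 * exp (Cmod (x, y) + Cmod (x, y) ^ 2)).
  assert (Hd : forall s, 0 <= s <= 1 -> Cmod (d s) <= M).
  { intros s Hs. unfold d, M.
    rewrite !Cmod_mult, Cmod_R, Cmod_Cexp. change (Re (a s, b s)) with (a s).
    rewrite Rabs_pos_eq by nra.
    assert (Hx : Rabs x <= Cmod (x, y)) by apply (re_le_Cmod (x, y)).
    assert (Hq : Rabs (x * x - y * y) <= Cmod (x, y) ^ 2).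
    { replace (x * x - y * y) with (Re ((x, y) * (x, y))%C) by (simpl; ring).
      eapply Rle_trans; [apply re_le_Cmod|]. rewrite Cmod_mult; apply Req_le; ring. }
    assert (Ha : a s <= Cmod (x, y) + Cmod (x, y) ^ 2).
    { unfold a. apply Rabs_le_between in Hx, Hq.
      assert (0 <= Cmod (x, y)) by apply Cmod_ge_0.
      assert (- s * x <= Cmod (x, y)) by nra.
      assert (0 <= s * s <= 1) by nra.
      set (q := x * x - y * y) in *. set (c2 := Cmod (x, y) ^ 2) in *.
      assert (s * s * q <= c2) by (assert (0 <= c2) by (unfold c2; nra); nra).
      assert (0 <= c2) by (unfold c2; nra). lra. }
    apply Rle_trans with (1 * (Cmod (x, y) ^ 3) * exp (Cmod (x, y) + Cmod (x, y) ^ 2)).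
    - apply Rmult_le_compat.
      + apply Rmult_le_pos; [nra|]. repeat apply Rmult_le_pos; apply Cmod_ge_0.
      + apply Rlt_le, exp_pos.
      + apply Rmult_le_compat; try nra.
        repeat apply Rmult_le_pos; apply Cmod_ge_0.
      + destruct Ha as [Ha| ->]; [apply Rlt_le, exp_increasing, Ha|apply Rle_refl].
    - rewrite Rmult_1_l; apply Rle_refl. }
  (* fr and fi are the real and imaginary parts of s -> E2(su). *)
  assert (Dr : forall s, is_derive fr s (Re (d s))).
  { intros s. unfold fr, d, a, b. auto_derive; auto. unfold Cexp; simpl. unfold Rdiv; field. }
  assert (Di : forall s, is_derive fi s (Im (d s))).
  { intros s. unfold fi, d, a, b. auto_derive; auto. unfold Cexp; simpl. unfold Rdiv; field. }
  assert (H : forall (f : R -> R) (df : R -> R), (forall s, is_derive f s (df s)) ->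
    (forall s, 0 <= s <= 1 -> Rabs (df s) <= M) -> Rabs (f 1 - f 0) <= M).
  { intros f df Hf Hb. destruct (MVT_gen f 0 1 df) as [c [Hc ->]].
    - intros; apply Hf.
    - intros s _. apply continuity_pt_filterlim, (ex_derive_continuous f).
      eexists; apply Hf.
    - rewrite Rmin_left, Rmax_right in Hc by lra. rewrite Rminus_0_r, Rmult_1_r; auto. }
  assert (Hr := H fr _ Dr (fun s Hs => Rle_trans _ _ _ (re_le_Cmod _) (Hd s Hs))).
  assert (Hi := H fi _ Di (fun s Hs => Rle_trans _ _ _ (im_le_Cmod _) (Hd s Hs))).
  eapply Rle_trans; [apply Cmod_le_add|].
  replace (Re (E2 (x, y) - 1)%C) with (fr 1 - fr 0).
  replace (Im (E2 (x, y) - 1)%C) with (fi 1 - fi 0).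
  - lra.
  - unfold fi, a, b. rewrite HE.
    replace (- (0) * x + 0 * 0 * (x * x - y * y) / 2) with 0 by field.
    replace (- (0) * y + 0 * 0 * (x * y)) with 0 by ring.
    rewrite exp_0, sin_0, cos_0.
    replace (- (1) * x + 1 * 1 * (x * x - y * y) / 2)
      with (- x + (x * x - y * y) / 2) by field.
    replace (- (1) * y + 1 * 1 * (x * y)) with (- y + x * y) by ring.
    unfold Cexp; simpl; ring.
  - unfold fr, a, b. rewrite HE.
    replace (- (0) * x + 0 * 0 * (x * x - y * y) / 2) with 0 by field.
    replace (- (0) * y + 0 * 0 * (x * y)) with 0 by ring.
    rewrite exp_0, sin_0, cos_0.
    replace (- (1) * x + 1 * 1 * (x * x - y * y) / 2)
      with (- x + (x * x - y * y) / 2) by field.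
    replace (- (1) * y + 1 * 1 * (x * y)) with (- y + x * y) by ring.
    unfold Cexp; simpl; ring.
Qed.

(** * The digamma and trigamma series *)

Lemma nondecreasing_of_derive (f df : R -> R) (a b : R) : a <= b ->
  (forall x, a <= x <= b -> is_derive f x (df x)) ->
  (forall x, a <= x <= b -> 0 <= df x) -> f a <= f b.
Proof.
  intros Hab Hd Hp.
  destruct (MVT_gen f a b df) as [c [Hc E]].
  - intros x Hx; rewrite Rmin_left, Rmax_right in Hx by auto; apply Hd; lra.
  - intros x Hx; rewrite Rmin_left, Rmax_right in Hx by auto.
    apply continuity_pt_filterlim, (ex_derive_continuous f).
    eexists; apply Hd; lra.
  - rewrite Rmin_left, Rmax_right in Hc by auto. specialize (Hp c Hc). nra.
Qed.

(** Differentiates a pointwise limit of functions: a quadratic bound that is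
    uniform along the sequence passes to the limit. *)
Lemma is_derive_of_quadratic_bound (f : R -> R) (x l M delta : R) : 0 < delta ->
  (forall y, Rabs (y - x) < delta -> Rabs (f y - f x - l * (y - x)) <= M * (y - x) ^ 2) ->
  is_derive f x l.
Proof.
  intros Hd H. apply is_derive_Reals. intros eps Heps.
  assert (HM : 0 < Rabs M + 1) by (pose proof (Rabs_pos M); lra).
  assert (Hpos : 0 < Rmin delta (eps / (Rabs M + 1))).
  { apply Rmin_pos; auto. apply Rdiv_lt_0_compat; auto. }
  exists (mkposreal _ Hpos). intros h Hh Hlt; simpl in Hlt.
  specialize (H (x + h)). replace (x + h - x) with h in H by ring.
  assert (H1 : Rabs h < delta) by apply (Rlt_le_trans _ _ _ Hlt (Rmin_l _ _)).
  assert (H2 : Rabs h < eps / (Rabs M + 1)) by apply (Rlt_le_trans _ _ _ Hlt (Rmin_r _ _)).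
  specialize (H H1).
  replace ((f (x + h) - f x) / h - l) with ((f (x + h) - f x - l * h) / h) by (field; auto).
  unfold Rdiv; rewrite Rabs_mult, Rabs_inv.
  assert (Hh0 : 0 < Rabs h) by (apply Rabs_pos_lt; auto).
  apply Rle_lt_trans with (Rabs M * Rabs h).
  - apply Rmult_le_reg_r with (Rabs h); auto.
    rewrite Rmult_assoc, Rinv_l, Rmult_1_r by lra.
    eapply Rle_trans; [apply H|]. rewrite <- (pow2_abs h).
    pose proof (Rle_abs M). nra.
  - apply Rlt_div_r in H2; [|lra]. nra.
Qed.

Lemma ln_le_sub_1 (y : R) : 0 < y -> ln y <= y - 1.
Proof. intros H. pose proof (exp_ineq1_le (ln y)). rewrite exp_ln in *; lra. Qed.

Lemma ln_diff_bounds (x y : R) : 0 < x -> 0 < y ->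
  (y - x) / y <= ln y - ln x <= (y - x) / x.
Proof.
  intros Hx Hy. split.
  - pose proof (ln_le_sub_1 (x / y) (Rdiv_lt_0_compat _ _ Hx Hy)).
    rewrite ln_div in H by auto. replace ((y - x) / y) with (- (x / y - 1)) by (field; lra). lra.
  - pose proof (ln_le_sub_1 (y / x) (Rdiv_lt_0_compat _ _ Hy Hx)).
    rewrite ln_div in H by auto. replace ((y - x) / x) with (y / x - 1) by (field; lra). lra.
Qed.

(** The error of the trapezoid rule for the integral of 1/t over [x, x + 1],
    bounded in a form that telescopes. With y = (x + 1)/x it amounts to 2 (y -
    1)/(y + 1) <= ln y <= (y - 1/y)/2 for y >= 1. *)
Lemma ln_trapezoid (x : R) : 0 < x ->
  - (/ 4 * (/ x ^ 2 - / (x + 1) ^ 2)) <= ln (x + 1) - ln x - / 2 * (/ x + / (x + 1)) <= 0.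
Proof.
  intros Hx. set (y := (x + 1) / x).
  assert (Hy : 1 <= y) by (unfold y; apply Rle_div_r; lra).
  assert (E : ln (x + 1) - ln x = ln y) by (unfold y; rewrite ln_div; lra).
  rewrite E; split.
  - assert (H : 0 <= ln y - 2 * (y - 1) / (y + 1)).
    { replace 0 with (ln 1 - 2 * (1 - 1) / (1 + 1)) by (rewrite ln_1; field).
      apply (nondecreasing_of_derive (fun y => ln y - 2 * (y - 1) / (y + 1))
               (fun y => (y - 1) ^ 2 / (y * (y + 1) ^ 2))); auto; intros u Hu.
      - auto_derive; [lra|]. field; lra.
      - apply Rdiv_le_0_compat; nra. }
    apply Rle_trans with (2 * (y - 1) / (y + 1) - / 2 * (/ x + / (x + 1))); [|lra].
    replace (2 * (y - 1) / (y + 1)) with (2 / (2 * x + 1)) by (unfold y; field; lra).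
    apply Rminus_le_0.
    replace (_ - _) with (((2 * x + 1) ^ 2 - 2 * x * (x + 1)) / (4 * x ^ 2 * (x + 1) ^ 2 * (2 * x + 1)))
     by (field; lra).
    apply Rdiv_le_0_compat; [nra|]. repeat apply Rmult_lt_0_compat; try lra; nra.
  - assert (H : 0 <= (y - / y) / 2 - ln y).
    { replace 0 with ((1 - / 1) / 2 - ln 1) by (rewrite ln_1; field).
      apply (nondecreasing_of_derive (fun y => (y - / y) / 2 - ln y)
               (fun y => (y - 1) ^ 2 / (2 * y ^ 2))); auto; intros u Hu.
      - auto_derive; [lra|]. field; lra.
      - apply Rdiv_le_0_compat; nra. }
    replace ((y - / y) / 2) with (/ 2 * (/ x + / (x + 1))) in H by (unfold y; field; lra). lra.
Qed.

Fixpoint psum (f : nat -> R) (n : nat) : R :=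
  match n with 0%nat => 0 | S k => psum f k + f k end.

Lemma psum_S (f : nat -> R) (n : nat) : psum f (S n) = psum f n + f n.
Proof. reflexivity. Qed.

Lemma psum_ext (f g : nat -> R) (n : nat) : (forall k, f k = g k) -> psum f n = psum g n.
Proof. intros H; induction n; simpl; congruence. Qed.

Lemma psum_scal (c : R) (f : nat -> R) (n : nat) :
  psum (fun k => c * f k) n = c * psum f n.
Proof. induction n; simpl; lra. Qed.

Lemma psum_le (f g : nat -> R) (n : nat) : (forall k, f k <= g k) -> psum f n <= psum g n.
Proof. intros H; induction n; simpl; [lra|]. specialize (H n); lra. Qed.

Lemma psum_const (c : R) (n : nat) : psum (fun _ => c) n = INR n * c.
Proof. induction n; [simpl; ring|]. rewrite S_INR; simpl; rewrite IHn; ring. Qed.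

Lemma sum_n_m_psum (f : nat -> R) (n : nat) : sum_n_m f 1 n = psum (fun k => f (S k)) n.
Proof.
  induction n; [rewrite sum_n_m_zero by lia; reflexivity|].
  rewrite sum_n_Sm, IHn by lia. reflexivity.
Qed.

Lemma is_lim_seq_inv_plus (x : R) : is_lim_seq (fun n => / (x + INR n)) 0.
Proof.
  apply (is_lim_seq_inv (fun n => x + INR n) p_infty); [|discriminate].
  apply (is_lim_seq_plus _ _ (Finite x) p_infty).
  - apply is_lim_seq_const. - apply is_lim_seq_INR. - reflexivity.
Qed.

Lemma is_lim_seq_inv_INR : is_lim_seq (fun n => / INR n) 0.
Proof.
  apply is_lim_seq_ext with (fun n => / (0 + INR n)).
  - intros n; now rewrite Rplus_0_l.
  - apply is_lim_seq_inv_plus.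
Qed.

Lemma is_lim_seq_ln_ratio (x : R) : 0 <= x ->
  is_lim_seq (fun n => ln (INR n) - ln (x + INR n)) 0.
Proof.
  intros Hx. apply is_lim_seq_le_le_loc with (fun n => - x * / INR n) (fun _ => 0).
  - exists 1%nat; intros n Hn. apply le_INR in Hn; simpl in Hn.
    pose proof (ln_diff_bounds (INR n) (x + INR n)).
    destruct H as [H1 H2]; try lra.
    replace ((x + INR n - INR n) / INR n) with (x * / INR n) in H2 by (field; lra).
    assert (ln (INR n) <= ln (x + INR n)) by (apply ln_le; lra). split; lra.
  - evar_last; [apply (is_lim_seq_scal_l _ (- x)), is_lim_seq_inv_INR|]. simpl; f_equal; ring.
  - apply is_lim_seq_const.
Qed.

(** The sum runs over k <= N, N + 1 terms, to match the product in Euler's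
    limit. *)
Definition psiN (x : R) (N : nat) : R := ln (INR N) - psum (fun k => / (x + INR k)) (S N).
Definition psi1N (x : R) (n : nat) : R := psum (fun k => / (x + INR k) ^ 2) n.
Definition psi (x : R) : R := real (Lim_seq (psiN x)).
Definition psi1 (x : R) : R := real (Lim_seq (psi1N x)).

(** Adding ln(x + n) - 1/(2 (x + n)) to minus the partial sums of the 1/(x +
    k) gives a sequence whose increments are the errors of the trapezoid rule.
    It starts at ln x - 1/(2x), so the telescoping bound is the asymptotic
    expansion of psi. *)
Lemma psi_spec (x : R) : 0 < x ->
  is_lim_seq (psiN x) (psi x) /\ Rabs (psi x - (ln x - / 2 * / x)) <= / 4 * / x ^ 2.
Proof.
  intros Hx.
  set (w := fun n => ln (x + INR n) - / 2 * / (x + INR n) - psum (fun k => / (x + INR k)) n).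
  destruct (telescoping_cv w (fun n => / 4 * / (x + INR n) ^ 2)) as [l [Hl Hb]].
  { intros n. unfold w; simpl psum. pose proof (pos_INR n).
    destruct (ln_trapezoid (x + INR n)) as [H1 H2]; [lra|].
    rewrite S_INR. replace (x + (INR n + 1)) with (x + INR n + 1) by ring.
    apply Rabs_le_between. split; lra. }
  { intros n. pose proof (pos_INR n).
    apply Rmult_le_pos; [lra|]. apply Rlt_le, Rinv_0_lt_compat. nra. }
  assert (Hp : is_lim_seq (psiN x) l).
  { apply is_lim_seq_ext_loc with (fun N => w (S N) + ((ln (INR N) - ln ((x + 1) + INR N)) + / 2 * / ((x + 1) + INR N))).
    - exists 0%nat; intros n _. unfold w, psiN. rewrite S_INR.
      replace (x + (INR n + 1)) with (x + 1 + INR n) by ring. ring.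
    - replace l with (l + (0 + / 2 * 0)) by ring.
      apply (is_lim_seq_plus' _ _ _ _).
      + apply (is_lim_seq_incr_1 w); auto.
      + apply (is_lim_seq_plus' _ _ _ _).
        * apply is_lim_seq_ln_ratio; lra.
        * apply (is_lim_seq_scal_l _ (/ 2) (Finite 0)), is_lim_seq_inv_plus. }
  assert (E : psi x = l) by (unfold psi; now rewrite (is_lim_seq_unique _ _ Hp)).
  rewrite E; split; auto.
  specialize (Hb 0%nat). unfold w in Hb; simpl psum in Hb. simpl INR in Hb.
  rewrite Rplus_0_r, Rminus_0_r in Hb. exact Hb.
Qed.

(** The sequence 1/(x + n) + psi1N x n starts at 1/x and has increments 1/(y^2
    (y + 1)) with y = x + n, at most 1/y^2 - 1/(y + 1)^2. *)
Lemma psi1_spec (x : R) : 0 < x ->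
  is_lim_seq (psi1N x) (psi1 x) /\ Rabs (psi1 x - / x) <= / x ^ 2.
Proof.
  intros Hx.
  set (w := fun n => / (x + INR n) + psi1N x n).
  destruct (telescoping_cv w (fun n => / (x + INR n) ^ 2)) as [l [Hl Hb]].
  { intros n. unfold w, psi1N; rewrite psum_S. pose proof (pos_INR n).
    rewrite S_INR. replace (x + (INR n + 1)) with (x + INR n + 1) by ring.
    set (y := x + INR n) in *. assert (0 < y) by (unfold y; lra).
    set (s := psum _ n).
    replace (/ (y + 1) + (s + / y ^ 2) - (/ y + s)) with (/ (y ^ 2 * (y + 1))) by (field; lra).
    rewrite Rabs_pos_eq.
    2: { apply Rlt_le, Rinv_0_lt_compat; nra. }
    apply Rminus_le_0.
    replace (_ - _) with (y / (y ^ 2 * (y + 1) ^ 2)) by (field; lra).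
    apply Rdiv_le_0_compat; [lra|]. apply Rmult_lt_0_compat; nra. }
  { intros n. pose proof (pos_INR n). apply Rlt_le, Rinv_0_lt_compat. nra. }
  assert (Hp : is_lim_seq (psi1N x) l).
  { apply is_lim_seq_ext with (fun n => w n - / (x + INR n)).
    - intros n; unfold w; ring.
    - replace l with (l - 0) by ring.
      apply (is_lim_seq_minus' _ _ _ _); auto using is_lim_seq_inv_plus. }
  assert (E : psi1 x = l) by (unfold psi1; now rewrite (is_lim_seq_unique _ _ Hp)).
  rewrite E; split; auto.
  specialize (Hb 0%nat). unfold w, psi1N in Hb; simpl psum in Hb. simpl INR in Hb.
  rewrite !Rplus_0_r in Hb. exact Hb.
Qed.

Lemma psi1N_le (x : R) (n : nat) : 0 < x -> psi1N x n <= psi1 x.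
Proof.
  intros Hx. apply (is_lim_seq_incr_compare (psi1N x)).
  - apply psi1_spec; auto.
  - intros k; unfold psi1N; rewrite psum_S. pose proof (pos_INR k).
    assert (0 < / (x + INR k) ^ 2) by (apply Rinv_0_lt_compat; nra). lra.
Qed.

Lemma is_derive_psi (x : R) : 0 < x -> is_derive psi x (psi1 x).
Proof.
  intros Hx.
  apply (is_derive_of_quadratic_bound _ _ _ (2 / x * psi1 x) (x / 2)); [lra|].
  intros y Hy. apply Rabs_lt_between in Hy.
  assert (Hy0 : 0 < y) by lra.
  set (u := fun N => psiN y N - psiN x N - psi1N x (S N) * (y - x)).
  assert (Hu : is_lim_seq u (psi y - psi x - psi1 x * (y - x))).
  { apply (is_lim_seq_minus' _ _ _ _); [apply (is_lim_seq_minus' _ _ _ _)|].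
    - apply psi_spec; auto. - apply psi_spec; auto.
    - apply (is_lim_seq_scal_r _ (y - x) (Finite _)), (is_lim_seq_incr_1 (psi1N x)), psi1_spec; auto. }
  assert (Hb : forall N, - (2 / x * psi1 x * (y - x) ^ 2) <= u N <= 0).
  { intros N.
    replace (u N) with (- psum (fun k => (y - x) ^ 2 * (/ (x + INR k) ^ 2 * / (y + INR k))) (S N)).
    2: { unfold u, psiN, psi1N. generalize (S N); intros n.
         assert (psum (fun k => (y - x) ^ 2 * (/ (x + INR k) ^ 2 * / (y + INR k))) n
                 = psum (fun k => / (y + INR k)) n - psum (fun k => / (x + INR k)) n +
                   psum (fun k => / (x + INR k) ^ 2) n * (y - x)); [|lra].
         induction n; [simpl; ring|]. rewrite !psum_S, IHn. pose proof (pos_INR n).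
         field; lra. }
    rewrite psum_scal.
    assert (0 <= psum (fun k => / (x + INR k) ^ 2 * / (y + INR k)) (S N) <= 2 / x * psi1N x (S N)).
    { split.
      - replace 0 with (psum (fun _ => 0) (S N)) by (rewrite psum_const; ring).
        apply psum_le. intros k. pose proof (pos_INR k).
        apply Rmult_le_pos; apply Rlt_le, Rinv_0_lt_compat; nra.
      - unfold psi1N; rewrite <- psum_scal. apply psum_le. intros k. pose proof (pos_INR k).
        rewrite Rmult_comm. apply Rmult_le_compat_r.
        + apply Rlt_le, Rinv_0_lt_compat; nra.
        + replace (2 / x) with (/ (x / 2)) by (field; lra). apply Rinv_le_contravar; lra. }
    pose proof (psi1N_le x (S N) Hx).
    assert (2 / x * psi1N x (S N) <= 2 / x * psi1 x).
    { apply Rmult_le_compat_l; auto. apply Rlt_le, Rdiv_lt_0_compat; lra. }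
    pose proof (pow2_ge_0 (y - x)). split; nra. }
  assert (H0 : 0 <= 2 / x * psi1 x * (y - x) ^ 2) by (specialize (Hb 0%nat); lra).
  apply Rabs_le_between; split.
  - apply (is_lim_seq_le (fun _ => - (2 / x * psi1 x * (y - x) ^ 2)) u (Finite _) (Finite _));
      [apply Hb|apply is_lim_seq_const|auto].
  - apply Rle_trans with 0; auto.
    apply (is_lim_seq_le u (fun _ => 0) (Finite _) (Finite _)); [apply Hb|auto|apply is_lim_seq_const].
Qed.

(** * The reciprocal Gamma function *)

Lemma RtoC_neq_0 (x : R) : x <> 0 -> RtoC x <> 0.
Proof. intros H E; apply H, RtoC_inj, E. Qed.

Lemma Cplus_INR_neq_0 (x : R) (n : nat) : 0 < x -> (RtoC x + INR n)%C <> 0.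
Proof.
  intros H. rewrite <- RtoC_plus. apply RtoC_neq_0. pose proof (pos_INR n); lra.
Qed.

(** This is Gamma(x)/Gamma(x + z) exp(z psi(x) + z^2/2 psi'(x)); for x = j tau
    it is the j-th factor of the double gamma function. *)
Definition weierstrass (x : R) (z : C) : C := Clim_seq (cprod (fun k => E2 (z / (x + INR k))) 0).

(** The bound 1/x^2 comes from the sum of 1/(x + k)^3. The constant is uniform
    for x >= delta, which the product over x = j tau needs. *)
Lemma weierstrass_spec (delta : R) (z : C) : 0 < delta ->
  exists K : R, 0 <= K /\ forall x, delta <= x ->
    is_Clim (cprod (fun k => E2 (z / (x + INR k))) 0) (weierstrass x z) /\
    Cmod (weierstrass x z - 1)%C <= K / x ^ 2.
Proof.
  intros Hd.
  set (r := Cmod z). assert (Hr : 0 <= r) by apply Cmod_ge_0.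
  set (e := exp (r / delta + (r / delta) ^ 2)).
  assert (He : 0 < e) by apply exp_pos.
  set (K := (1 + / delta) ^ 2 * (2 * (r ^ 3 * e))).
  assert (HK : 0 <= K).
  { unfold K. apply Rmult_le_pos; [apply pow2_ge_0|].
    apply Rmult_le_pos; [lra|]. apply Rmult_le_pos; [apply pow_le; auto|lra]. }
  exists (2 * (exp (K / delta ^ 2) * K)). split.
  { pose proof (exp_pos (K / delta ^ 2)). nra. }
  intros x Hx.
  destruct (cprod_cv_0 (fun k => E2 (z / (x + INR k))) (fun n => K / (x + INR n) ^ 2))
    as [l [Hl Hb]].
  - intros n. pose proof (pos_INR n). rewrite S_INR.
    eapply Rle_trans; [apply E2_sub_1|].
    set (y := x + INR n).
    assert (Hy : delta <= y) by (unfold y; lra).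
    replace (Cmod (z / (x + INR n))%C) with (r / y).
    2: { rewrite Cmod_div by (apply Cplus_INR_neq_0; lra).
         rewrite <- RtoC_plus, Cmod_R, Rabs_pos_eq; [reflexivity|lra]. }
    replace (x + (INR n + 1)) with (y + 1) by (unfold y; ring).
    assert (Hu : 0 <= r / y <= r / delta).
    { split; [apply Rdiv_le_0_compat; lra|].
      apply Rmult_le_compat_l; auto. apply Rinv_le_contravar; lra. }
    assert (Hexp : exp (r / y + (r / y) ^ 2) <= e).
    { assert (r / y + (r / y) ^ 2 <= r / delta + (r / delta) ^ 2) as [Hlt | ->] by nra.
      - apply Rlt_le, exp_increasing, Hlt. - apply Rle_refl. }
    apply Rle_trans with (2 * ((r / y) ^ 3 * e)).
    { apply Rmult_le_compat_l; [lra|]. apply Rmult_le_compat_l; auto. apply pow_le; lra. }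
    (* The sum of 1/y^3 telescopes against 1/y^2 - 1/(y + 1)^2 only up to the
       ratio (y + 1)/y, which is bounded on y >= delta. *)
    assert (Hq : (y + 1) <= (1 + / delta) * y).
    { assert (1 <= / delta * y) by (rewrite <- (Rinv_l delta) by lra;
        apply Rmult_le_compat_l; [apply Rlt_le, Rinv_0_lt_compat; lra|lra]). lra. }
    assert (Hq2 : (y + 1) ^ 2 <= (1 + / delta) ^ 2 * y ^ 2).
    { rewrite <- Rpow_mult_distr. apply pow_incr; lra. }
    replace (2 * ((r / y) ^ 3 * e)) with ((2 * (r ^ 3 * e)) * (/ y ^ 3)) by (field; lra).
    unfold K. set (c := (1 + / delta) ^ 2) in *.
    assert (Hc : 0 <= 2 * (r ^ 3 * e)).
    { apply Rmult_le_pos; [lra|]. apply Rmult_le_pos; [apply pow_le; auto|lra]. }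
    replace (c * (2 * (r ^ 3 * e)) / y ^ 2 - c * (2 * (r ^ 3 * e)) / (y + 1) ^ 2)
      with ((2 * (r ^ 3 * e)) * (c * (/ y ^ 2 - / (y + 1) ^ 2))) by (field; lra).
    apply Rmult_le_compat_l; auto.
    apply Rminus_le_0.
    replace (_ - _) with ((c * y ^ 2 * ((2 * y + 1)) - y * (y + 1) ^ 2) / (y ^ 4 * (y + 1) ^ 2))
      by (field; lra).
    apply Rdiv_le_0_compat.
    + nra.
    + apply Rmult_lt_0_compat; apply pow_lt; lra.
  - intros n. pose proof (pos_INR n). apply Rdiv_le_0_compat; auto. apply pow_lt; lra.
  - assert (E : weierstrass x z = l) by (apply is_Clim_unique; auto).
    rewrite E; split; auto.
    eapply Rle_trans; [apply Hb|]. simpl INR. rewrite Rplus_0_r.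
    replace (2 * (exp (K / delta ^ 2) * K) / x ^ 2)
      with (2 * (exp (K / delta ^ 2) * (K / x ^ 2))) by (field; lra).
    apply Rmult_le_compat_l; [lra|].
    assert (0 <= K / x ^ 2) by (apply Rdiv_le_0_compat; auto; apply pow_lt; lra).
    apply Rmult_le_compat_r; auto.
    assert (K / x ^ 2 <= K / delta ^ 2) as [Hlt | ->].
    { apply Rmult_le_compat_l; auto. apply Rinv_le_contravar; [apply pow_lt; auto|].
      apply pow_incr; lra. }
    + apply Rlt_le, exp_increasing, Hlt. + apply Rle_refl.
Qed.

(** The sequence whose limit the definition of [RGamma] takes. *)
Definition RGamma_seq (z : C) (N : nat) : C :=
  (Cexp (- z * ln (INR N)) * cprod (fun k => (z + INR k)%C) 0 N / INR (fact N))%C.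

Lemma RtoC_INR_fact_neq_0 (N : nat) : RtoC (INR (fact N)) <> 0.
Proof. apply RtoC_neq_0, INR_fact_neq_0. Qed.

(** The exponentials in the factors E2 add up to the partial sums of psi and
    psi', up to the term ln N of [psiN], which accounts for N^(-z). *)
Lemma RGamma_seq_shift (x : R) (z : C) (N : nat) : 0 < x ->
  RGamma_seq (x + z) N =
  (RGamma_seq x N * Cexp (- (z * psiN x N) - z ^ 2 / 2 * psi1N x (S N))
   * cprod (fun k => E2 (z / (x + INR k))) 0 N)%C.
Proof.
  intros Hx. unfold RGamma_seq, psiN, psi1N.
  assert (H : forall M, (cprod (fun k => x + z + INR k) 0 M =
    cprod (fun k => x + INR k) 0 M * cprod (fun k => E2 (z / (x + INR k))) 0 M *
    Cexp (z * psum (fun k => / (x + INR k))%R (S M)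
          - z ^ 2 / 2 * psum (fun k => / (x + INR k) ^ 2)%R (S M)))%C).
  { assert (Hs : forall n, (x + z + INR n =
      (x + INR n) * E2 (z / (x + INR n)) *
       Cexp (z * (/ (x + INR n))%R - z ^ 2 / 2 * (/ (x + INR n) ^ 2)%R))%C).
    { intros n. pose proof (pos_INR n). pose proof (Cplus_INR_neq_0 x n Hx).
      unfold E2. set (u := (z / (x + INR n))%C).
      replace (z * (/ (x + INR n))%R - z ^ 2 / 2 * (/ (x + INR n) ^ 2)%R)%C
        with (- (- u + u ^ 2 / 2))%C.
      2: { rewrite !RtoC_inv, RtoC_pow, RtoC_plus by (try apply pow_nonzero; lra).
           unfold u. field; auto. }
      transitivity (((x + INR n) * (1 + u)) * (Cexp (- u + u ^ 2 / 2) * Cexp (- (- u + u ^ 2 / 2))))%C; [|ring].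
      rewrite <- Cexp_plus, Cplus_opp_r, Cexp_0. unfold u; field; auto. }
    induction M as [|M IH].
    - rewrite !cprod_point. simpl psum. rewrite !Rplus_0_l. apply Hs.
    - rewrite !cprod_S, IH, (Hs (S M)) by lia.
      rewrite (psum_S _ (S M)), (psum_S _ (S M)), !RtoC_plus.
      set (p := psum _ _). set (q := psum _ _).
      match goal with |- (_ * _ * Cexp ?e * (_ * _ * Cexp ?e'))%C = (_ * Cexp ?e'')%C =>
        replace e'' with (e + e')%C by ring end.
      rewrite Cexp_plus. ring. }
  rewrite H, RtoC_minus.
  match goal with |- (Cexp ?e1 * (_ * _ * Cexp ?e2) / _ = Cexp ?e3 * _ / _ * Cexp ?e4 * _)%C =>
    assert (E : (Cexp e1 * Cexp e2 = Cexp e3 * Cexp e4)%C) by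
     (rewrite <- !Cexp_plus; f_equal; ring) end.
  revert E. set (A1 := Cexp _). set (A2 := Cexp _). set (A3 := Cexp _). set (A4 := Cexp _).
  intros E. unfold Cdiv.
  match goal with |- (A1 * (?p * ?q * A2) * ?i)%C = _ =>
    transitivity (A1 * A2 * p * q * i)%C; [ring|] end.
  rewrite E; ring.
Qed.

Lemma RGamma_seq_1 (N : nat) : (1 <= N)%nat -> RGamma_seq (RtoC 1) N = RtoC (1 + / INR N).
Proof.
  intros HN. apply le_INR in HN; simpl in HN.
  unfold RGamma_seq.
  replace (- (1) * ln (INR N))%C with (RtoC (- ln (INR N))) by (rewrite RtoC_opp; ring).
  rewrite Cexp_RtoC, exp_Ropp, exp_ln by lra.
  assert (H : forall M, cprod (fun k => (1 + INR k)%C) 0 M = RtoC (INR (fact (S M)))).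
  { induction M as [|M IH].
    - rewrite cprod_point, <- RtoC_plus. f_equal; simpl; ring.
    - rewrite cprod_S, IH, <- RtoC_plus, <- RtoC_mult by lia. f_equal.
      rewrite (fact_simpl (S M)), mult_INR, (S_INR (S M)); ring. }
  rewrite H, fact_simpl, mult_INR, S_INR.
  rewrite <- RtoC_mult, <- RtoC_div by apply INR_fact_neq_0. f_equal.
  field; split; (lra || apply INR_fact_neq_0).
Qed.

Lemma is_Clim_RGamma_seq_shift (x : R) (z l : C) : 0 < x -> is_Clim (RGamma_seq x) l ->
  is_Clim (RGamma_seq (x + z)) (l * Cexp (- (z * psi x) - z ^ 2 / 2 * psi1 x) * weierstrass x z)%C.
Proof.
  intros Hx Hl.
  eapply is_Clim_ext; [intros n; symmetry; apply RGamma_seq_shift; auto|].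
  apply is_Clim_mult; [apply is_Clim_mult; auto|].
  - apply is_Clim_exp. unfold Cminus.
    apply is_Clim_ext with (fun n => (- z) * psiN x n + (- (z ^ 2 / 2)) * psi1N x (S n))%C.
    { intros n; ring. }
    replace (- (z * psi x) + - (z ^ 2 / 2 * psi1 x))%C
      with ((- z) * psi x + (- (z ^ 2 / 2)) * psi1 x)%C by ring.
    apply is_Clim_plus; apply is_Clim_mult; try apply is_Clim_const; apply is_Clim_RtoC.
    + apply psi_spec; auto.
    + apply (is_lim_seq_incr_1 (psi1N x)), psi1_spec; auto.
  - destruct (weierstrass_spec x z Hx) as [K [_ HK]]. apply HK; lra.
Qed.

Lemma is_Clim_RGamma_seq_1 : is_Clim (RGamma_seq (RtoC 1)) 1.
Proof.
  apply is_Clim_ext_loc with (fun n => RtoC (1 + / INR n)).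
  - exists 1%nat; intros n Hn; symmetry; apply RGamma_seq_1; auto.
  - apply is_Clim_RtoC.
    assert (H : is_lim_seq (fun n => 1 + / INR n) (1 + 0)).
    { apply (is_lim_seq_plus' _ _ _ _); [apply is_lim_seq_const|apply is_lim_seq_inv_INR]. }
    rewrite Rplus_0_r in H; exact H.
Qed.

(** Euler's limit is explicit at 1, and [is_Clim_RGamma_seq_shift] carries the
    convergence from 1 to any complex number. *)
Lemma RGamma_spec (z : C) : is_Clim (RGamma_seq z) (RGamma z).
Proof.
  replace z with (RtoC 1 + (z - 1))%C at 1 by ring.
  pose proof (is_Clim_RGamma_seq_shift 1 (z - 1)%C 1 Rlt_0_1 is_Clim_RGamma_seq_1) as H.
  assert (E : RGamma z = (1 * Cexp (- ((z - 1) * psi 1) - (z - 1) ^ 2 / 2 * psi1 1) * weierstrass 1 (z - 1))%C).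
  { unfold RGamma. apply is_Clim_unique.
    replace (1 + (z - 1))%C with z in H by ring. exact H. }
  rewrite E. exact H.
Qed.

Lemma RGamma_1 : RGamma 1 = 1.
Proof. apply is_Clim_unique, is_Clim_RGamma_seq_1. Qed.

Lemma RGamma_shift (x : R) (z : C) : 0 < x ->
  RGamma (x + z)%C = (RGamma x * Cexp (- (z * psi x) - z ^ 2 / 2 * psi1 x) * weierstrass x z)%C.
Proof.
  intros Hx. apply is_Clim_unique, is_Clim_RGamma_seq_shift; auto. apply RGamma_spec.
Qed.

(** The shift from x back to 1 expresses 1 = RGamma 1 as a multiple of RGamma
    x. *)
Lemma RGamma_neq_0 (x : R) : 0 < x -> RGamma x <> 0.
Proof.
  intros Hx E. pose proof (RGamma_shift x (1 - x)%C Hx) as H.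
  replace (x + (1 - x))%C with (RtoC 1) in H by ring.
  rewrite RGamma_1, E, !Cmult_0_l in H. apply RtoC_inj in H; lra.
Qed.

Lemma RGamma_S (z : C) : RGamma z = (z * RGamma (z + 1))%C.
Proof.
  transitivity (Clim_seq (fun N => z * RGamma_seq (z + 1) N)%C).
  2: { apply is_Clim_unique, is_Clim_mult; [apply is_Clim_const|apply RGamma_spec]. }
  symmetry; apply is_Clim_unique.
  apply is_Clim_ext_loc with (fun N => RGamma_seq z N * (1 + (z + 1) * (/ INR N)%R))%C.
  - exists 1%nat; intros N HN. apply le_INR in HN; simpl in HN.
    unfold RGamma_seq.
    replace (- (z + 1) * ln (INR N))%C with (- z * ln (INR N) + RtoC (- ln (INR N)))%C
      by (rewrite RtoC_opp; ring).
    rewrite Cexp_plus, Cexp_RtoC, exp_Ropp, exp_ln by lra.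
    assert (H : forall M, (cprod (fun k => z + INR k) 0 M * (z + 1 + INR M) =
                 z * cprod (fun k => z + 1 + INR k) 0 M)%C).
    { induction M as [|M IH].
      - rewrite !cprod_point. simpl INR. ring.
      - rewrite !cprod_S, S_INR, RtoC_plus, (Cmult_assoc z), <- IH by lia. ring. }
    replace (1 + (z + 1) * (/ INR N)%R)%C with ((z + 1 + INR N) * (/ INR N)%R)%C.
    2: { rewrite RtoC_inv by lra. field. apply RtoC_neq_0; lra. }
    set (A := Cexp _). set (i := RtoC (/ INR N)).
    transitivity (A * i * (cprod (fun k => z + INR k) 0 N * (z + 1 + INR N)) / INR (fact N))%C.
    { unfold Cdiv; ring. }
    rewrite H. unfold Cdiv; ring.
  - replace (RGamma z) with (RGamma z * (1 + (z + 1) * 0))%C by ring.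
    apply is_Clim_mult; [apply RGamma_spec|].
    apply is_Clim_plus; [apply is_Clim_const|].
    apply is_Clim_mult; [apply is_Clim_const|].
    apply is_Clim_RtoC, is_lim_seq_inv_INR.
Qed.

(** * The real Gamma function and its logarithm *)

Definition ln_RGamma_seq (x : R) (N : nat) : R :=
  - x * ln (INR N) + psum (fun k => ln (x + INR k)) (S N) - ln (INR (fact N)).

Lemma RGamma_seq_real (x : R) (N : nat) : 0 < x -> RGamma_seq x N = RtoC (exp (ln_RGamma_seq x N)).
Proof.
  intros Hx. unfold RGamma_seq, ln_RGamma_seq.
  replace (- x * ln (INR N))%C with (RtoC (- x * ln (INR N))) by (rewrite RtoC_mult, RtoC_opp; ring).
  rewrite Cexp_RtoC.
  assert (H : forall M, cprod (fun k => (x + INR k)%C) 0 M = RtoC (exp (psum (fun k => ln (x + INR k)) (S M)))).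
  { induction M as [|M IH].
    - rewrite cprod_point, <- RtoC_plus. simpl psum. simpl INR. rewrite Rplus_0_l, exp_ln by lra; auto.
    - pose proof (pos_INR (S M)).
      rewrite cprod_S, IH, (psum_S _ (S M)), exp_plus, (exp_ln (x + INR (S M))), RtoC_mult, RtoC_plus by (lia || lra).
      reflexivity. }
  rewrite H, <- RtoC_mult, <- RtoC_div by apply INR_fact_neq_0. f_equal.
  unfold Rminus; rewrite !exp_plus, exp_Ropp, exp_ln by apply INR_fact_lt_0. reflexivity.
Qed.

Lemma GammaR_spec (x : R) : 0 < x ->
  0 < GammaR x /\ RGamma x = RtoC (/ GammaR x) /\
  is_lim_seq (ln_RGamma_seq x) (- ln (GammaR x)).
Proof.
  intros Hx. destruct (RGamma_spec x) as [H1 H2].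
  pose proof (RGamma_neq_0 x Hx) as H0.
  set (r := Re (RGamma x)) in *.
  assert (Ei : Im (RGamma x) = 0).
  { pose proof (is_lim_seq_ext _ (fun _ => 0) _ (fun n => f_equal Im (RGamma_seq_real x n Hx)) H2) as H.
    apply is_lim_seq_unique in H. rewrite Lim_seq_const in H. injection H; auto. }
  assert (E : RGamma x = RtoC r) by (apply C_eq; auto).
  assert (L : is_lim_seq (fun n => exp (ln_RGamma_seq x n)) r)
    by exact (is_lim_seq_ext _ (fun n => exp (ln_RGamma_seq x n)) _ (fun n => f_equal Re (RGamma_seq_real x n Hx)) H1).
  assert (Hr : 0 < r).
  { assert (0 <= r).
    { apply (is_lim_seq_le (fun _ => 0) (fun n => exp (ln_RGamma_seq x n)) (Finite 0) (Finite r)); auto.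
      - intros; apply Rlt_le, exp_pos. - apply is_lim_seq_const. }
    destruct H as [|H]; auto. exfalso; apply H0. rewrite E, <- H; auto. }
  assert (G : GammaR x = / r).
  { unfold GammaR, Gamma. rewrite E, <- RtoC_inv by lra. reflexivity. }
  rewrite G, Rinv_inv, ln_Rinv, Ropp_involutive by auto.
  split; [apply Rinv_0_lt_compat; auto|]. split; auto.
  apply is_lim_seq_ext with (fun n => ln (exp (ln_RGamma_seq x n))).
  - intros; apply ln_exp.
  - apply is_lim_seq_continuous; auto. apply continuity_pt_filterlim, (ex_derive_continuous ln).
    auto_derive; auto.
Qed.

(** Each logarithm ln(x + k) differs from its tangent by at most a constant
    times (y - x)^2/(x + k)^2, and these bounds sum to psi1 x. *)
Lemma is_derive_ln_GammaR (x : R) : 0 < x -> is_derive (fun y => ln (GammaR y)) x (psi x).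
Proof.
  intros Hx.
  apply (is_derive_of_quadratic_bound _ _ _ (2 * psi1 x) (x / 2)); [lra|].
  intros y Hy. apply Rabs_lt_between in Hy.
  assert (Hy0 : 0 < y) by lra.
  set (u := fun N => ln_RGamma_seq x N - ln_RGamma_seq y N - psiN x N * (y - x)).
  assert (Hu : is_lim_seq u (ln (GammaR y) - ln (GammaR x) - psi x * (y - x))).
  { replace (ln (GammaR y) - ln (GammaR x)) with (- ln (GammaR x) - - ln (GammaR y)) by ring.
    apply (is_lim_seq_minus' _ _ _ _); [apply (is_lim_seq_minus' _ _ _ _)|].
    - apply GammaR_spec; auto. - apply GammaR_spec; auto.
    - apply (is_lim_seq_scal_r _ (y - x) (Finite _)), psi_spec; auto. }
  assert (Hb : forall N, 0 <= u N <= 2 * psi1 x * (y - x) ^ 2).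
  { intros N.
    set (f := fun k => (y - x) * / (x + INR k) - (ln (y + INR k) - ln (x + INR k))).
    replace (u N) with (psum f (S N)).
    2: { unfold u, psiN, ln_RGamma_seq. generalize (S N); intros n.
         assert (psum f n = (y - x) * psum (fun k => / (x + INR k)) n
              - (psum (fun k => ln (y + INR k)) n - psum (fun k => ln (x + INR k)) n)); [|lra].
         induction n; [simpl; ring|]. rewrite !psum_S, IHn. unfold f. ring. }
    assert (Hf : forall k, 0 <= f k <= 2 * (y - x) ^ 2 * / (x + INR k) ^ 2).
    { intros k. pose proof (pos_INR k).
      destruct (ln_diff_bounds (x + INR k) (y + INR k)) as [H1 H2]; try lra.
      replace (y + INR k - (x + INR k)) with (y - x) in H1, H2 by ring.
      unfold f; split; [unfold Rdiv in *; lra|].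
      apply Rle_trans with ((y - x) / (x + INR k) - (y - x) / (y + INR k)); [unfold Rdiv in *; lra|].
      replace ((y - x) / (x + INR k) - (y - x) / (y + INR k))
        with ((y - x) ^ 2 * (/ (x + INR k) * / (y + INR k))) by (field; lra).
      replace (2 * (y - x) ^ 2 * / (x + INR k) ^ 2)
        with ((y - x) ^ 2 * (/ (x + INR k) * / ((x + INR k) / 2))) by (field; lra).
      apply Rmult_le_compat_l; [apply pow2_ge_0|].
      apply Rmult_le_compat_l; [apply Rlt_le, Rinv_0_lt_compat; lra|].
      apply Rinv_le_contravar; lra. }
    split.
    - replace 0 with (psum (fun _ => 0) (S N)) by (rewrite psum_const; ring).
      apply psum_le; apply Hf.
    - apply Rle_trans with (2 * (y - x) ^ 2 * psi1N x (S N)).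
      + unfold psi1N; rewrite <- psum_scal; apply psum_le; apply Hf.
      + pose proof (psi1N_le x (S N) Hx). pose proof (pow2_ge_0 (y - x)). nra. }
  rewrite Rabs_pos_eq.
  - apply (is_lim_seq_le u (fun _ => 2 * psi1 x * (y - x) ^ 2) (Finite _) (Finite _));
      [apply Hb|auto|apply is_lim_seq_const].
  - apply (is_lim_seq_le (fun _ => 0) u (Finite _) (Finite _)); [apply Hb|apply is_lim_seq_const|auto].
Qed.

Lemma locally_pos (x : R) : 0 < x -> locally x (fun y => 0 < y).
Proof. intros Hx; apply (open_gt 0 x Hx). Qed.

Lemma digamma_eq (x : R) : 0 < x -> digamma x = psi x.
Proof.
  intros Hx. unfold digamma. destruct (GammaR_spec x Hx) as [Hp _].
  assert (H : is_derive GammaR x (psi x * GammaR x)).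
  { apply (is_derive_ext_loc (fun y => exp (ln (GammaR y)))).
    - apply (filter_imp (fun y => 0 < y)); [|apply locally_pos; auto].
      intros y Hy; apply exp_ln, GammaR_spec; auto.
    - evar_last; [apply (is_derive_comp exp (fun y => ln (GammaR y)))|].
      + apply is_derive_Reals, derivable_pt_lim_exp.
      + apply is_derive_ln_GammaR; auto.
      + unfold scal; simpl; unfold mult; simpl. rewrite exp_ln; auto. }
  rewrite (is_derive_unique _ _ _ H). field; lra.
Qed.

Lemma trigamma_eq (x : R) : 0 < x -> trigamma x = psi1 x.
Proof.
  intros Hx. unfold trigamma. apply is_derive_unique.
  apply (is_derive_ext_loc psi); [|apply is_derive_psi; auto].
  apply (filter_imp (fun y => 0 < y)); [|apply locally_pos; auto].
  intros y Hy; symmetry; apply digamma_eq; auto.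
Qed.

Lemma GammaR_S (x : R) : 0 < x -> GammaR (x + 1) = x * GammaR x.
Proof.
  intros Hx. destruct (GammaR_spec x Hx) as [H1 [H2 _]].
  destruct (GammaR_spec (x + 1)) as [H3 [H4 _]]; [lra|].
  pose proof (RGamma_S x) as E. rewrite <- RtoC_plus, H2, H4, <- RtoC_mult in E.
  apply RtoC_inj in E.
  replace (GammaR x) with (/ / GammaR x) by apply Rinv_inv. rewrite E. field; lra.
Qed.

Lemma GammaR_INR (n : nat) : GammaR (INR (S n)) = INR (fact n).
Proof.
  induction n as [|n IH].
  - destruct (GammaR_spec 1 Rlt_0_1) as [_ [H _]]. rewrite RGamma_1 in H.
    apply RtoC_inj in H. simpl. rewrite <- (Rinv_inv (GammaR 1)), <- H; field.
  - rewrite S_INR, GammaR_S, IH, fact_simpl, mult_INR by (apply lt_0_INR; lia). reflexivity.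
Qed.

(** The remainder in Stirling's formula, without the constant. *)
Definition binet (x : R) : R := ln (GammaR x) - ((x - / 2) * ln x - x).

Lemma ln_fact (n : nat) : (1 <= n)%nat ->
  ln (INR (fact n)) = binet (INR n) + (INR n + / 2) * ln (INR n) - INR n.
Proof.
  intros Hn. destruct n as [|n]; [lia|].
  unfold binet. rewrite GammaR_INR, fact_simpl, mult_INR, ln_mult by
    (apply INR_fact_lt_0 || (apply lt_0_INR; lia)). field.
Qed.

Lemma is_derive_binet (x : R) : 0 < x -> is_derive binet x (psi x - (ln x - / 2 * / x)).
Proof.
  intros Hx. unfold binet.
  evar_last.
  - apply (is_derive_minus (fun y => ln (GammaR y)) (fun x => (x - / 2) * ln x - x)).
    + apply is_derive_ln_GammaR; auto.
    + auto_derive; [auto|reflexivity].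
  - unfold minus, plus, opp; simpl. field; lra.
Qed.

(** By the expansion of psi, the derivative of [binet] is at most 1/(4 x^2) in
    absolute value. *)
Lemma binet_diff (x y : R) : 0 < x -> x <= y -> Rabs (binet y - binet x) <= / 4 * / x - / 4 * / y.
Proof.
  intros Hx Hxy.
  assert (Hb : forall u, x <= u <= y -> Rabs (psi u - (ln u - / 2 * / u)) <= / 4 * / u ^ 2)
    by (intros; apply psi_spec; lra).
  assert (H1 : - binet x - / 4 * / x <= - binet y - / 4 * / y).
  { apply (nondecreasing_of_derive (fun u => - binet u - / 4 * / u)
       (fun u => - (psi u - (ln u - / 2 * / u)) + / 4 * / u ^ 2)); auto.
    - intros u Hu. evar_last.
      + apply (is_derive_minus (fun u => - binet u) (fun u => / 4 * / u)).
        * apply (is_derive_opp binet), is_derive_binet; lra.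
        * auto_derive; [lra|reflexivity].
      + unfold minus, plus, opp; simpl. field; lra.
    - intros u Hu. specialize (Hb u Hu). apply Rabs_le_between in Hb; lra. }
  assert (H2 : binet x - / 4 * / x <= binet y - / 4 * / y).
  { apply (nondecreasing_of_derive (fun u => binet u - / 4 * / u)
       (fun u => (psi u - (ln u - / 2 * / u)) + / 4 * / u ^ 2)); auto.
    - intros u Hu. evar_last.
      + apply (is_derive_minus binet (fun u => / 4 * / u)).
        * apply is_derive_binet; lra.
        * auto_derive; [lra|reflexivity].
      + unfold minus, plus, opp; simpl. field; lra.
    - intros u Hu. specialize (Hb u Hu). apply Rabs_le_between in Hb; lra. }
  apply Rabs_le_between; lra.
Qed.

Lemma binet_cv : exists K, forall x, 0 < x -> Rabs (binet x - K) <= / 4 * / x.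
Proof.
  destruct (telescoping_cv (fun n => binet (1 + INR n)) (fun n => / 4 * / (1 + INR n))) as [K [HK _]].
  - intros n. pose proof (pos_INR n). rewrite S_INR. apply binet_diff; lra.
  - intros n. pose proof (pos_INR n). apply Rmult_le_pos; [lra|]. apply Rlt_le, Rinv_0_lt_compat; lra.
  - exists K. intros x Hx.
    destruct (INR_unbounded x) as [N HN].
    assert (Hb : forall n, - (/ 4 * / x) <= binet x - binet (1 + INR (n + N)) <= / 4 * / x).
    { intros n. pose proof (pos_INR n). rewrite plus_INR.
      apply Rabs_le_between. rewrite Rabs_minus_sym.
      eapply Rle_trans; [apply binet_diff; lra|].
      assert (0 < / (1 + (INR n + INR N))) by (apply Rinv_0_lt_compat; lra). lra. }
    apply (is_lim_seq_incr_n _ N) in HK.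
    assert (L : is_lim_seq (fun n => binet x - binet (1 + INR (n + N))) (binet x - K))
      by (apply (is_lim_seq_minus' _ _ _ _); [apply is_lim_seq_const|exact HK]).
    apply Rabs_le_between; split.
    + apply (is_lim_seq_le (fun _ => - (/ 4 * / x)) _ (Finite _) (Finite _)) with (3 := L);
       [apply Hb|apply is_lim_seq_const].
    + apply (is_lim_seq_le _ (fun _ => (/ 4 * / x)) (Finite _) (Finite _)) with (2 := L);
       [apply Hb|apply is_lim_seq_const].
Qed.

(** * Wallis integrals and Stirling's constant *)

Definition wallis (n : nat) : R := RInt (fun t => sin t ^ n) 0 (PI / 2).

Lemma ex_RInt_sin_pow (n : nat) : ex_RInt (fun t => sin t ^ n) 0 (PI / 2).
Proof.
  apply (ex_RInt_continuous (V := R_CompleteNormedModule)).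
  intros t _. apply (ex_derive_continuous (fun t => sin t ^ n)). auto_derive; auto.
Qed.

Lemma sin_range (t : R) : 0 < t < PI / 2 -> 0 < sin t <= 1.
Proof. intros H. split; [apply sin_gt_0; lra|apply SIN_bound]. Qed.

Lemma wallis_decr (n : nat) : wallis (S n) <= wallis n.
Proof.
  pose proof PI_RGT_0. apply RInt_le; try lra; try apply ex_RInt_sin_pow.
  intros t Ht. apply sin_range in Ht. simpl.
  pose proof (pow_lt (sin t) n (proj1 Ht)). nra.
Qed.

(** The integrand (n + 1) sin^n - (n + 2) sin^(n + 2) is the derivative of
    sin^(n + 1) cos, which vanishes at both ends. *)
Lemma wallis_rec (n : nat) : INR (n + 2) * wallis (n + 2) = INR (n + 1) * wallis n.
Proof.
  assert (H : is_RInt (fun t => INR (n + 1) * sin t ^ n - INR (n + 2) * sin t ^ (n + 2)) 0 (PI / 2)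
     (minus (sin (PI / 2) ^ (n + 1) * cos (PI / 2)) (sin 0 ^ (n + 1) * cos 0))).
  { apply (is_RInt_derive (V := R_CompleteNormedModule) (fun t => sin t ^ (n + 1) * cos t)).
    - intros t _. auto_derive; auto. rewrite Nat.add_1_r. simpl Init.Nat.pred.
      replace (n + 2)%nat with (S (S n)) by lia.
      pose proof (sin2_cos2 t); unfold Rsqr in *.
      assert (E : cos t * cos t = 1 - sin t * sin t) by lra.
      rewrite !S_INR. simpl pow.
      transitivity ((INR n + 1) * (cos t * cos t) * sin t ^ n - sin t * sin t * sin t ^ n); [ring|].
      rewrite E. ring.
    - intros t _.
      apply (ex_derive_continuous (fun t => INR (n + 1) * sin t ^ n - INR (n + 2) * sin t ^ (n + 2))).
      auto_derive; auto. }
  rewrite cos_PI2, sin_0, pow_i in H by lia.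
  assert (H' : is_RInt (fun t => INR (n + 1) * sin t ^ n - INR (n + 2) * sin t ^ (n + 2)) 0 (PI / 2)
     (minus (scal (INR (n + 1)) (wallis n)) (scal (INR (n + 2)) (wallis (n + 2))))).
  { apply (is_RInt_minus (V := R_NormedModule)); apply (is_RInt_scal (V := R_NormedModule)), (RInt_correct (V := R_CompleteNormedModule)), ex_RInt_sin_pow. }
  apply (is_RInt_unique (V := R_CompleteNormedModule)) in H.
  apply (is_RInt_unique (V := R_CompleteNormedModule)) in H'.
  rewrite H in H'. unfold minus, plus, opp, scal in H'; simpl in H'; unfold mult in H'; simpl in H'.
  lra.
Qed.

Lemma wallis_0 : wallis 0 = PI / 2.
Proof. unfold wallis; simpl. rewrite RInt_const. unfold scal; simpl; unfold mult; simpl. lra. Qed.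

Lemma wallis_1 : wallis 1 = 1.
Proof.
  assert (H : is_RInt (fun t => sin t ^ 1) 0 (PI / 2) (minus (- cos (PI / 2)) (- cos 0))).
  { apply (is_RInt_derive (V := R_CompleteNormedModule) (fun t => - cos t)).
    - intros t _. auto_derive; auto. ring.
    - intros t _. apply (ex_derive_continuous (fun t => sin t ^ 1)). auto_derive; auto. }
  unfold wallis. rewrite (is_RInt_unique _ _ _ _ H), cos_PI2, cos_0.
  unfold minus, plus, opp; simpl; ring.
Qed.

Lemma wallis_prod (n : nat) : INR (S n) * (wallis n * wallis (S n)) = PI / 2.
Proof.
  induction n as [|n IH].
  - rewrite wallis_0, wallis_1. simpl; ring.
  - rewrite <- IH. pose proof (wallis_rec n) as H.
    replace (n + 2)%nat with (S (S n)) in H by lia. replace (n + 1)%nat with (S n) in H by lia.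
    transitivity (wallis (S n) * (INR (S (S n)) * wallis (S (S n)))); [ring|]. rewrite H; ring.
Qed.

Lemma wallis_pos (n : nat) : 0 < wallis n.
Proof.
  assert (H : 0 <= wallis n).
  { apply RInt_ge_0; [pose proof PI_RGT_0; lra|apply ex_RInt_sin_pow|].
    intros t Ht; apply sin_range in Ht; apply pow_le; lra. }
  destruct H as [|H]; auto. pose proof (wallis_prod n) as E. rewrite <- H in E.
  pose proof PI_RGT_0. lra.
Qed.

Lemma ln_wallis_even (n : nat) :
  ln (wallis (2 * n)) = ln (INR (fact (2 * n))) - 2 * INR n * ln 2 - 2 * ln (INR (fact n)) + ln (PI / 2).
Proof.
  induction n as [|n IH].
  - simpl. rewrite wallis_0, ln_1; ring.
  - pose proof (wallis_rec (2 * n)) as H.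
    replace (2 * S n)%nat with (2 * n + 2)%nat by lia.
    pose proof (wallis_pos (2 * n)). pose proof (wallis_pos (2 * n + 2)).
    apply (f_equal ln) in H.
    rewrite !ln_mult in H by (auto; apply lt_0_INR; lia).
    replace (2 * n + 2)%nat with (S (S (2 * n))) in * by lia.
    replace (2 * n + 1)%nat with (S (2 * n)) in * by lia.
    rewrite !fact_simpl, !mult_INR, !ln_mult by
      (try apply Rmult_lt_0_compat; try apply INR_fact_lt_0; apply lt_0_INR; lia).
    assert (E : ln (INR (S (S (2 * n)))) = ln 2 + ln (INR (S n))).
    { replace (S (S (2 * n))) with (2 * S n)%nat by lia. rewrite mult_INR, ln_mult by (apply lt_0_INR; lia).
      reflexivity. }
    rewrite (S_INR n) in *. lra.
Qed.

(** The product (n + 1) W_n W_(n + 1) is constant and W is decreasing, so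
    W_n^2 is squeezed between pi/(2 (n + 1)) and pi/(2n). *)
Lemma ln_wallis_cv : is_lim_seq (fun n => 2 * ln (wallis (2 * n)) + ln (INR (2 * n))) (ln (PI / 2)).
Proof.
  pose proof PI_RGT_0.
  apply is_lim_seq_le_le_loc with (fun n => ln (PI / 2) - / INR n) (fun _ => ln (PI / 2)).
  - exists 1%nat. intros n Hn.
    assert (Hp : 0 < INR n) by (apply lt_0_INR; lia).
    pose proof (wallis_pos (2 * n)) as W0. pose proof (wallis_pos (S (2 * n))) as W1.
    pose proof (wallis_pos (pred (2 * n))) as W2.
    pose proof (wallis_decr (2 * n)) as D1. pose proof (wallis_decr (pred (2 * n))) as D2.
    pose proof (wallis_prod (2 * n)) as P1. pose proof (wallis_prod (pred (2 * n))) as P2.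
    replace (S (pred (2 * n))) with (2 * n)%nat in * by lia.
    set (w := wallis (2 * n)) in *.
    assert (Hm : INR (2 * n) = 2 * INR n) by (rewrite mult_INR; reflexivity).
    rewrite S_INR in P1. rewrite Hm in *.
    assert (E : 2 * ln w + ln (2 * INR n) = ln (w * w * (2 * INR n))).
    { rewrite !ln_mult by (try lra; apply Rmult_lt_0_compat; lra). ring. }
    rewrite E.
    assert (0 < w * w) by nra.
    split.
    + assert (L : ln (PI / 2) <= ln (w * w * (2 * INR n + 1))) by (apply ln_le; nra).
      rewrite ln_mult in L by lra. rewrite (ln_mult (w * w)) by lra.
      destruct (ln_diff_bounds (2 * INR n) (2 * INR n + 1)) as [_ L2]; try lra.
      replace ((2 * INR n + 1 - 2 * INR n) / (2 * INR n)) with (/ 2 * / INR n) in L2 by (field; lra).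
      assert (0 < / INR n) by (apply Rinv_0_lt_compat; auto). lra.
    + apply ln_le; [apply Rmult_lt_0_compat; lra|]. nra.
  - replace (ln (PI / 2)) with (ln (PI / 2) - 0) at 1 by ring.
    apply (is_lim_seq_minus' _ _ _ _); [apply is_lim_seq_const|apply is_lim_seq_inv_INR].
  - apply is_lim_seq_const.
Qed.

(** Expressing W_(2n) by factorials turns [ln_wallis_cv] into the equation -2
    K + 2 ln 2 + 2 ln(pi/2) = ln(pi/2) for the limit K of [binet]. *)
Lemma binet_spec (x : R) : 0 < x -> Rabs (binet x - / 2 * ln (2 * PI)) <= / 4 * / x.
Proof.
  intros Hx. destruct binet_cv as [K HK].
  assert (Hlim : forall c, 0 < c -> is_lim_seq (fun n => binet (c * INR n)) K).
  { intros c Hc.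
    assert (Hz : is_lim_seq (fun n => / 4 * (/ c * / INR n)) 0).
    { replace (Finite 0) with (Finite (/ 4 * (/ c * 0))) by (f_equal; ring).
      do 2 apply (is_lim_seq_scal_l _ _ (Finite _)). apply is_lim_seq_inv_INR. }
    apply is_lim_seq_le_le_loc with (fun n => K - / 4 * (/ c * / INR n)) (fun n => K + / 4 * (/ c * / INR n)).
    - exists 1%nat; intros n Hn. assert (0 < INR n) by (apply lt_0_INR; lia).
      specialize (HK (c * INR n)). rewrite Rinv_mult in HK.
      assert (H0 : 0 < c * INR n) by (apply Rmult_lt_0_compat; auto).
      apply HK, Rabs_le_between in H0. lra.
    - replace (Finite K) with (Finite (K - 0)) by (f_equal; ring).
      apply (is_lim_seq_minus' _ _ _ _); [apply is_lim_seq_const|exact Hz].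
    - replace (Finite K) with (Finite (K + 0)) by (f_equal; ring).
      apply (is_lim_seq_plus' _ _ _ _); [apply is_lim_seq_const|exact Hz]. }
  assert (E : / 2 * ln (2 * PI) = K).
  2: { rewrite E; auto. }
  assert (L : is_lim_seq (fun n => 2 * ln (wallis (2 * n)) + ln (INR (2 * n)))
     (2 * K - 4 * K + 2 * ln 2 + 2 * ln (PI / 2))).
  { apply is_lim_seq_ext_loc with
     (fun n => 2 * binet (2 * INR n) - 4 * binet (1 * INR n) + 2 * ln 2 + 2 * ln (PI / 2)).
    - exists 1%nat. intros n Hn. rewrite ln_wallis_even.
      rewrite !ln_fact by lia. rewrite mult_INR. replace (INR 2) with 2 by reflexivity.
      rewrite Rmult_1_l. rewrite ln_mult by (try lra; apply lt_0_INR; lia). field.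
    - apply (is_lim_seq_plus' _ _ _ _); [apply (is_lim_seq_plus' _ _ _ _)|]; try apply is_lim_seq_const.
      apply (is_lim_seq_minus' _ _ _ _); apply (is_lim_seq_scal_l _ _ (Finite _)); apply Hlim; lra. }
  pose proof (is_lim_seq_unique _ _ L) as E1. rewrite (is_lim_seq_unique _ _ ln_wallis_cv) in E1.
  injection E1 as E1. pose proof PI_RGT_0.
  unfold Rdiv in E1. rewrite ln_mult, ln_Rinv in E1 by lra. rewrite ln_mult by lra. lra.
Qed.

(** * The constants of the double gamma function *)

Definition psi_sum (tau : R) (n : nat) : R := psum (fun k => psi (INR (S k) * tau)) n.
Definition psi1_sum (tau : R) (n : nat) : R := psum (fun k => psi1 (INR (S k) * tau)) n.

(** The sum of psi(k tau) for 1 <= k <= n, minus its expansion ln n! + n ln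
    tau - ln(n + 1)/(2 tau). The argument n + 1 instead of n keeps the
    logarithm meaningful at n = 0. *)
Definition psi_defect (tau : R) (n : nat) : R :=
  psi_sum tau n - ln (INR (fact n)) - INR n * ln tau + / (2 * tau) * ln (INR n + 1).
Definition psi1_defect (tau : R) (n : nat) : R :=
  psi1_sum tau n - / tau * ln (INR n + 1).

Lemma inv_sub_ln_bounds (y : R) : 0 < y -> 0 <= / y - (ln (y + 1) - ln y) <= / y - / (y + 1).
Proof.
  intros Hy. destruct (ln_diff_bounds y (y + 1)) as [H1 H2]; [lra|lra|].
  replace ((y + 1 - y) / (y + 1)) with (/ (y + 1)) in H1 by (field; lra).
  replace ((y + 1 - y) / y) with (/ y) in H2 by (field; lra). lra.
Qed.

Lemma inv_sqr_le (y : R) : 1 <= y -> / y ^ 2 <= 2 * (/ y - / (y + 1)).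
Proof.
  intros Hy. apply Rminus_le_0.
  replace (_ - _) with ((y - 1) / (y ^ 2 * (y + 1))) by (field; lra).
  apply Rdiv_le_0_compat; [lra|]. apply Rmult_lt_0_compat; [apply pow_lt|]; lra.
Qed.

Lemma psi1_defect_cv (tau : R) : 0 < tau -> exists l : R, is_lim_seq (psi1_defect tau) l.
Proof.
  intros Ht.
  set (c := 2 / tau ^ 2 + / tau).
  assert (Hc : 0 < / tau) by (apply Rinv_0_lt_compat; auto).
  assert (Hc2 : 0 < / tau ^ 2) by (apply Rinv_0_lt_compat, pow_lt; auto).
  destruct (telescoping_cv (psi1_defect tau) (fun n => c * / (INR n + 1))) as [l [Hl _]]; eauto.
  - intros n. unfold psi1_defect, psi1_sum. rewrite psum_S, S_INR.
    set (y := INR n + 1). assert (Hy : 1 <= y) by (unfold y; pose proof (pos_INR n); lra).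
    set (s := psum _ n).
    assert (H : Rabs (psi1 (y * tau) - / (y * tau)) <= / (y * tau) ^ 2)
      by (apply psi1_spec; apply Rmult_lt_0_compat; lra).
    replace (/ (y * tau) ^ 2) with (/ tau ^ 2 * / y ^ 2) in H by (field; lra).
    replace (/ (y * tau)) with (/ tau * / y) in H by (field; lra).
    apply Rabs_le_between in H.
    pose proof (inv_sqr_le y Hy). destruct (inv_sub_ln_bounds y) as [H1 H2]; [lra|].
    assert (/ tau ^ 2 * / y ^ 2 <= / tau ^ 2 * (2 * (/ y - / (y + 1)))) by (apply Rmult_le_compat_l; lra).
    assert (0 <= / tau * (/ y - (ln (y + 1) - ln y))) by (apply Rmult_le_pos; lra).
    assert (/ tau * (/ y - (ln (y + 1) - ln y)) <= / tau * (/ y - / (y + 1))) by (apply Rmult_le_compat_l; lra).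
    replace (c * / y - c * / (y + 1)) with (/ tau ^ 2 * (2 * (/ y - / (y + 1))) + / tau * (/ y - / (y + 1)))
      by (unfold c; field; lra).
    apply Rabs_le_between; split; lra.
  - intros n. pose proof (pos_INR n). apply Rmult_le_pos; [unfold c, Rdiv; lra|].
    apply Rlt_le, Rinv_0_lt_compat; lra.
Qed.

Lemma psi_defect_cv (tau : R) : 0 < tau -> exists l : R, is_lim_seq (psi_defect tau) l.
Proof.
  intros Ht.
  set (c := / 2 * / tau ^ 2 + / 2 * / tau).
  assert (Hc : 0 < / tau) by (apply Rinv_0_lt_compat; auto).
  assert (Hc2 : 0 < / tau ^ 2) by (apply Rinv_0_lt_compat, pow_lt; auto).
  destruct (telescoping_cv (psi_defect tau) (fun n => c * / (INR n + 1))) as [l [Hl _]]; eauto.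
  - intros n. unfold psi_defect, psi_sum.
    rewrite psum_S, fact_simpl, mult_INR, ln_mult by (apply INR_fact_lt_0 || (apply lt_0_INR; lia)).
    rewrite S_INR.
    set (y := INR n + 1). assert (Hy : 1 <= y) by (unfold y; pose proof (pos_INR n); lra).
    set (s := psum _ n).
    assert (H : Rabs (psi (y * tau) - (ln (y * tau) - / 2 * / (y * tau))) <= / 4 * / (y * tau) ^ 2)
      by (apply psi_spec; apply Rmult_lt_0_compat; lra).
    replace (/ (y * tau) ^ 2) with (/ tau ^ 2 * / y ^ 2) in H by (field; lra).
    replace (/ (y * tau)) with (/ tau * / y) in H by (field; lra).
    rewrite ln_mult in H by lra.
    apply Rabs_le_between in H.
    pose proof (inv_sqr_le y Hy). destruct (inv_sub_ln_bounds y) as [H1 H2]; [lra|].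
    assert (/ tau ^ 2 * / y ^ 2 <= / tau ^ 2 * (2 * (/ y - / (y + 1)))) by (apply Rmult_le_compat_l; lra).
    assert (0 <= / tau * (/ y - (ln (y + 1) - ln y))) by (apply Rmult_le_pos; lra).
    assert (/ tau * (/ y - (ln (y + 1) - ln y)) <= / tau * (/ y - / (y + 1))) by (apply Rmult_le_compat_l; lra).
    replace (c * / y - c * / (y + 1)) with (/ 4 * (/ tau ^ 2 * (2 * (/ y - / (y + 1)))) + / 2 * (/ tau * (/ y - / (y + 1))))
      by (unfold c; field; lra).
    replace (/ (2 * tau)) with (/ 2 * / tau) by (field; lra).
    assert (y * ln tau = INR n * ln tau + ln tau) by (unfold y; ring).
    apply Rabs_le_between; split; lra.
  - intros n. pose proof (pos_INR n). apply Rmult_le_pos; [unfold c, Rdiv; lra|].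
    apply Rlt_le, Rinv_0_lt_compat; lra.
Qed.

Lemma is_lim_seq_inv_multiples (c : R) (tau : R) : 0 < tau ->
  is_lim_seq (fun n => c * / (INR n * tau)) 0.
Proof.
  intros Ht. apply is_lim_seq_ext with (fun n => (c * / tau) * / INR n).
  { intros n. rewrite Rinv_mult. ring. }
  replace (Finite 0) with (Finite (c * / tau * 0)) by (f_equal; ring).
  apply (is_lim_seq_scal_l _ _ (Finite _)), is_lim_seq_inv_INR.
Qed.

Lemma is_lim_seq_of_bound (u : nat -> R) (l : R) (B : nat -> R) :
  (forall n, (1 <= n)%nat -> Rabs (u n - l) <= B n) -> is_lim_seq B 0 -> is_lim_seq u l.
Proof.
  intros H HB. apply is_lim_seq_le_le_loc with (fun n => l - B n) (fun n => l + B n).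
  - exists 1%nat; intros n Hn. specialize (H n Hn). apply Rabs_le_between in H; lra.
  - replace (Finite l) with (Finite (l - 0)) by (f_equal; ring).
    apply (is_lim_seq_minus' _ _ _ _); [apply is_lim_seq_const|auto].
  - replace (Finite l) with (Finite (l + 0)) by (f_equal; ring).
    apply (is_lim_seq_plus' _ _ _ _); [apply is_lim_seq_const|auto].
Qed.

Lemma psi1_lim (tau : R) : 0 < tau -> is_lim_seq (fun n => psi1 (INR n * tau)) 0.
Proof.
  intros Ht. apply is_lim_seq_of_bound with (fun n => (1 + / tau) * / (INR n * tau)).
  - intros n Hn. apply le_INR in Hn. change (INR 1) with 1 in Hn.
    set (y := INR n * tau). assert (Hy : tau <= y) by (unfold y; nra).
    destruct (psi1_spec y) as [_ H]; [lra|]. apply Rabs_le_between in H.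
    assert (0 < / y <= / tau) by (split; [apply Rinv_0_lt_compat|apply Rinv_le_contravar]; lra).
    replace (/ y ^ 2) with (/ y * / y) in H by (field; lra).
    apply Rabs_le_between; split; nra.
  - apply is_lim_seq_inv_multiples; auto.
Qed.

Lemma psi_lim (tau : R) : 0 < tau -> is_lim_seq (fun n => psi (INR n * tau) - ln (INR n)) (ln tau).
Proof.
  intros Ht. apply is_lim_seq_of_bound with (fun n => (1 + / tau) * / (INR n * tau)).
  - intros n Hn. apply le_INR in Hn. change (INR 1) with 1 in Hn.
    replace (psi (INR n * tau) - ln (INR n) - ln tau) with (psi (INR n * tau) - ln (INR n * tau))
      by (rewrite ln_mult by lra; ring).
    set (y := INR n * tau). assert (Hy : tau <= y) by (unfold y; nra).
    destruct (psi_spec y) as [_ H]; [lra|]. apply Rabs_le_between in H.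
    assert (0 < / y <= / tau) by (split; [apply Rinv_0_lt_compat|apply Rinv_le_contravar]; lra).
    replace (/ y ^ 2) with (/ y * / y) in H by (field; lra).
    apply Rabs_le_between; split; nra.
  - apply is_lim_seq_inv_multiples; auto.
Qed.

Lemma binet_lim (tau : R) : 0 < tau -> is_lim_seq (fun n => binet (INR n * tau)) (/ 2 * ln (2 * PI)).
Proof.
  intros Ht. apply is_lim_seq_of_bound with (fun n => / 4 * / (INR n * tau)).
  - intros n Hn. apply binet_spec. apply Rmult_lt_0_compat; auto. apply lt_0_INR; lia.
  - apply is_lim_seq_inv_multiples; auto.
Qed.

Lemma ln_succ_lim : is_lim_seq (fun n => ln (INR n + 1) - ln (INR n)) 0.
Proof.
  pose proof (is_lim_seq_ln_ratio 1 Rle_0_1) as H.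
  apply is_lim_seq_opp in H.
  apply is_lim_seq_ext with (2 := eq_ind _ (is_lim_seq _) H _ (f_equal Finite Ropp_0)).
  intros n. rewrite (Rplus_comm 1). ring.
Qed.

Lemma sum_n_m_multiples (f g : R -> R) (tau : R) (M : nat) : 0 < tau -> (forall x, 0 < x -> f x = g x) ->
  sum_n_m (fun k => f (INR k * tau)) 1 M = psum (fun k => g (INR (S k) * tau)) M.
Proof.
  intros Ht H. rewrite sum_n_m_psum. apply psum_ext. intros k. apply H.
  apply Rmult_lt_0_compat; auto. apply lt_0_INR; lia.
Qed.

(** The limit D(tau) is that of [psi1_defect] up to an explicit term in ln
    tau, which the term - tau ln tau of b(tau) cancels. *)
Lemma dG_b_eq (tau delta : R) : 0 < tau -> is_lim_seq (psi1_defect tau) delta ->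
  dG_b tau = - tau ^ 2 * delta.
Proof.
  intros Ht Hd.
  assert (E : dG_D tau = delta - / tau * ln tau).
  { unfold dG_D. rewrite (is_lim_seq_unique _ (Finite (delta - / tau * ln tau))); [reflexivity|].
    apply is_lim_seq_ext_loc with (fun M => psi1_defect tau M + / tau * (ln (INR M + 1) - ln (INR M))
       - / 2 * psi1 (INR M * tau) - / tau * (psi (INR M * tau) - ln (INR M))).
    - exists 1%nat. intros M HM. destruct M as [|M]; [lia|].
      replace (S M - 1)%nat with M by lia.
      assert (0 < INR (S M) * tau) by (apply Rmult_lt_0_compat; auto; apply lt_0_INR; lia).
      rewrite (sum_n_m_multiples trigamma psi1), trigamma_eq, digamma_eq by auto using trigamma_eq.
      unfold psi1_defect, psi1_sum. rewrite psum_S. field; lra.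
    - replace (delta - / tau * ln tau) with (delta + / tau * 0 - / 2 * 0 - / tau * ln tau) by ring.
      apply (is_lim_seq_minus' _ _ _ _); [apply (is_lim_seq_minus' _ _ _ _);
        [apply (is_lim_seq_plus' _ _ _ _); [exact Hd|]|]|];
        apply (is_lim_seq_scal_l _ _ (Finite _)).
      + apply ln_succ_lim. + apply psi1_lim; auto. + apply psi_lim; auto. }
  unfold dG_b. rewrite E. field; lra.
Qed.

(** Stirling's formula is used twice in C(tau): at M for ln M!, and at M tau
    for the term ln Gamma(M tau). The first use contributes ln(2 pi)/2, which
    the term with ln(2 pi tau) in a(tau) cancels; in the second the constant
    is absorbed by the division by sqrt(2 pi). *)
Lemma dG_a_eq (tau kappa : R) : 0 < tau -> is_lim_seq (psi_defect tau) kappa ->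
  dG_a tau = tau * (ln tau - kappa).
Proof.
  intros Ht Hk. pose proof PI_RGT_0.
  set (h := / 2 * ln (2 * PI)).
  assert (E : dG_C tau = kappa + h - / 2 * ln tau + / (2 * tau) * ln tau).
  { unfold dG_C. rewrite (is_lim_seq_unique _ (Finite (kappa + h - / 2 * ln tau + / (2 * tau) * ln tau))); [reflexivity|].
    apply is_lim_seq_ext_loc with (fun M => psi_defect tau M + binet (INR M * 1)
       - / 2 * (psi (INR M * tau) - ln (INR M))
       - / (2 * tau) * (ln (INR M + 1) - ln (INR M))
       + (/ (2 * tau) * ln tau) - / tau * (binet (INR M * tau) - h)).
    - exists 1%nat. intros M HM. destruct M as [|M]; [lia|].
      replace (S M - 1)%nat with M by lia.
      assert (Hp : 0 < INR (S M)) by (apply lt_0_INR; lia).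
      assert (0 < INR (S M) * tau) by (apply Rmult_lt_0_compat; auto).
      rewrite (sum_n_m_multiples digamma psi), digamma_eq by auto using digamma_eq.
      assert (Es : ln (GammaR (INR (S M) * tau) / sqrt (2 * PI)) = ln (GammaR (INR (S M) * tau)) - h).
      { pose proof (sqrt_lt_R0 (2 * PI)). pose proof (sqrt_sqrt (2 * PI)) as Hs.
        rewrite ln_div by (apply GammaR_spec || idtac; lra).
        unfold h. rewrite <- Hs at 2 by lra. rewrite ln_mult by lra. field. }
      assert (Eb : ln (GammaR (INR (S M) * tau)) = binet (INR (S M) * tau) +
        ((INR (S M) * tau - / 2) * (ln (INR (S M)) + ln tau) - INR (S M) * tau)).
      { unfold binet. rewrite <- ln_mult by auto. ring. }
      rewrite Es, Eb.
      unfold psi_defect, psi_sum. rewrite psum_S, ln_fact, Rmult_1_r by lia.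
      field; lra.
    - replace (kappa + h - / 2 * ln tau + / (2 * tau) * ln tau)
        with (kappa + h - / 2 * ln tau - / (2 * tau) * 0 + / (2 * tau) * ln tau - / tau * (h - h)) by ring.
      apply (is_lim_seq_minus' _ _ _ _).
      + apply (is_lim_seq_plus' _ _ _ _); [|apply is_lim_seq_const].
        apply (is_lim_seq_minus' _ _ _ _).
        * apply (is_lim_seq_minus' _ _ _ _).
          -- apply (is_lim_seq_plus' _ _ _ _); [exact Hk|]. apply binet_lim; lra.
          -- apply (is_lim_seq_scal_l _ _ (Finite _)), psi_lim; auto.
        * apply (is_lim_seq_scal_l _ _ (Finite _)), ln_succ_lim.
      + apply (is_lim_seq_scal_l _ _ (Finite _)).
        apply (is_lim_seq_minus' _ _ _ _); [apply binet_lim; auto|apply is_lim_seq_const]. }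
  unfold dG_a. rewrite E, ln_mult by lra. unfold h. field; lra.
Qed.

(** * The functional equation of the double gamma function *)

Definition dG_factor (tau : R) (z : C) (j : nat) : C :=
  (GammaR (INR j * tau)%R * RGamma (z + INR j * tau)
   * Cexp (z * digamma (INR j * tau)%R + z ^ 2 / 2 * trigamma (INR j * tau)%R))%C.

Definition dG_exponent (tau : R) (z : C) : C :=
  (dG_a tau * (z / tau) + dG_b tau * (z ^ 2 / (2 * tau ^ 2)))%C.

Definition dG_partial (tau : R) (z : C) (N : nat) : C :=
  (/ tau * RGamma z * Cexp (dG_exponent tau z) * cprod (dG_factor tau z) 1 N)%C.

Lemma INR_S_mul_pos (tau : R) (j : nat) : 0 < tau -> 0 < INR (S j) * tau.
Proof. intros; apply Rmult_lt_0_compat; auto; apply lt_0_INR; lia. Qed.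

Lemma dG_factor_weierstrass (tau : R) (z : C) (j : nat) : 0 < tau ->
  dG_factor tau z (S j) = weierstrass (INR (S j) * tau) z.
Proof.
  intros Ht. pose proof (INR_S_mul_pos tau j Ht) as Hx. unfold dG_factor.
  rewrite digamma_eq, trigamma_eq, <- RtoC_mult, Cplus_comm, RGamma_shift by auto.
  set (x := INR (S j) * tau) in *.
  destruct (GammaR_spec x Hx) as [Hg [E _]]. rewrite E.
  set (e1 := Cexp _). set (e2 := Cexp _).
  transitivity ((GammaR x * (/ GammaR x)%R) * (e1 * e2) * weierstrass x z)%C; [ring|].
  rewrite <- RtoC_mult, Rinv_r by lra.
  unfold e1, e2; rewrite <- Cexp_plus.
  replace (_ + _)%C with (RtoC 0) by ring. rewrite Cexp_0. ring.
Qed.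

Lemma dG_partial_cv (tau : R) (z : C) : 0 < tau -> is_Clim (dG_partial tau z) (dG tau z).
Proof.
  intros Ht.
  assert (H : exists l, is_Clim (cprod (dG_factor tau z) 1) l).
  { destruct (weierstrass_spec tau z Ht) as [K [HK Hb]].
    destruct (cprod_cv (dG_factor tau z) (fun n => 2 * (K / tau ^ 2) * / (INR n + 1))) as [l [Hl _]]; eauto.
    - intros n. rewrite dG_factor_weierstrass by auto.
      pose proof (pos_INR n). rewrite S_INR. set (y := INR n + 1).
      assert (Hy : 1 <= y) by (unfold y; lra).
      destruct (Hb (y * tau)) as [_ H1]; [nra|].
      eapply Rle_trans; [apply H1|].
      replace (K / (y * tau) ^ 2) with (K / tau ^ 2 * / y ^ 2) by (field; lra).
      replace (_ - _) with (K / tau ^ 2 * (2 * (/ y - / (y + 1)))) by (field; lra).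
      apply Rmult_le_compat_l; [|apply inv_sqr_le; auto].
      apply Rdiv_le_0_compat; auto. apply pow_lt; auto.
    - intros n. pose proof (pos_INR n).
      assert (0 <= K / tau ^ 2) by (apply Rdiv_le_0_compat; auto; apply pow_lt; auto).
      apply Rmult_le_pos; [lra|]. apply Rlt_le, Rinv_0_lt_compat; lra. }
  destruct H as [l Hl].
  assert (E : dG tau z = (/ tau * RGamma z * Cexp (dG_exponent tau z) * l)%C).
  { unfold dG. f_equal. apply is_Clim_unique. exact Hl. }
  rewrite E. unfold dG_partial. apply is_Clim_mult; [apply is_Clim_const|exact Hl].
Qed.

Lemma cprod_dG_factor_step (tau : R) (z : C) (N : nat) : 0 < tau ->
  cprod (dG_factor tau z) 1 N =
  (cprod (dG_factor tau (z + 1)) 1 N * cprod (fun j => z + INR j * tau) 1 N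
   * Cexp (- (psi_sum tau N + (z + / 2) * psi1_sum tau N)))%C.
Proof.
  intros Ht. unfold psi_sum, psi1_sum.
  induction N as [|N IH].
  - rewrite !cprod_empty by lia. simpl psum.
    replace (- (0 + (z + / 2) * 0))%C with (RtoC 0) by ring. rewrite Cexp_0; ring.
  - rewrite !cprod_S, !psum_S, IH, !RtoC_plus by lia.
    set (s := psum _ N). set (s1 := psum _ N).
    pose proof (INR_S_mul_pos tau N Ht) as Hx.
    assert (Hf : dG_factor tau z (S N) =
      (dG_factor tau (z + 1) (S N) * (z + INR (S N) * tau)
        * Cexp (- (psi (INR (S N) * tau) + (z + / 2) * psi1 (INR (S N) * tau))))%C).
    { unfold dG_factor. rewrite digamma_eq, trigamma_eq by auto.
      rewrite (RGamma_S (z + INR (S N) * tau)).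
      replace (z + 1 + INR (S N) * tau)%C with (z + INR (S N) * tau + 1)%C by ring.
      set (x := INR (S N) * tau).
      replace (z * psi x + z ^ 2 / 2 * psi1 x)%C
        with (((z + 1) * psi x + (z + 1) ^ 2 / 2 * psi1 x) + (- (psi x + (z + / 2) * psi1 x)))%C.
      - rewrite Cexp_plus. ring.
      - field. }
    rewrite Hf.
    replace (- (s + psi (INR (S N) * tau) + (z + / 2) * (s1 + psi1 (INR (S N) * tau))))%C
      with ((- (s + (z + / 2) * s1)) + (- (psi (INR (S N) * tau) + (z + / 2) * psi1 (INR (S N) * tau))))%C by ring.
    rewrite Cexp_plus; ring.
Qed.

Lemma cprod_arith_RGamma_seq (tau : R) (z : C) (N : nat) : 0 < tau ->
  (z * cprod (fun j => z + INR j * tau) 1 N =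
   RGamma_seq (z / tau) N * Cexp (z / tau * ln (INR N) + (ln (INR (fact N)) + (INR N + 1) * ln tau)%R))%C.
Proof.
  intros Ht. unfold RGamma_seq.
  assert (H : forall M, (z * cprod (fun j => z + INR j * tau) 1 M =
     cprod (fun k => z / tau + INR k) 0 M * Cexp ((INR M + 1) * ln tau)%R)%C).
  { assert (Hz : (tau * (z / tau))%C = z) by (field; apply RtoC_neq_0; lra).
    induction M as [|M IH].
    - rewrite cprod_empty, cprod_point by lia.
      simpl INR. rewrite Rplus_0_l, Rmult_1_l, Cexp_ln by auto.
      rewrite <- Hz at 1. ring.
    - rewrite !cprod_S, Cmult_assoc, IH by lia.
      replace (RtoC ((INR (S M) + 1) * ln tau)) with (RtoC ((INR M + 1) * ln tau) + ln tau)%C.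
      2: { rewrite <- RtoC_plus, S_INR. f_equal; ring. }
      rewrite Cexp_plus, (Cexp_ln tau) by auto.
      replace (z + INR (S M) * tau)%C with (tau * (z / tau) + INR (S M) * tau)%C by (rewrite Hz; reflexivity).
      ring. }
  rewrite H, RtoC_plus, !Cexp_plus, (Cexp_ln (INR (fact N))) by apply INR_fact_lt_0.
  set (e := Cexp (RtoC _)).
  pose proof (Cexp_plus (- (z / tau) * ln (INR N)) (z / tau * ln (INR N))) as E.
  replace (- (z / tau) * ln (INR N) + z / tau * ln (INR N))%C with (RtoC 0) in E by ring.
  rewrite Cexp_0 in E.
  set (c := cprod _ 0 N). set (e1 := Cexp (- (z / tau) * ln (INR N))) in *.
  set (e2 := Cexp (z / tau * ln (INR N))) in *.
  transitivity (c * e * (e1 * e2))%C; [rewrite <- E; unfold e; ring|].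
  field. apply RtoC_INR_fact_neq_0.
Qed.

(** The N-th partial product at z is that at z + 1, times the N-th term of
    Euler's limit at z/tau, times an exponential. In terms of the limits kappa
    and delta of the defects, a(tau) = tau (ln tau - kappa) and b(tau) = -
    tau^2 delta, so the exponent is a combination of the null sequences
    psi_defect - kappa, psi1_defect - delta and ln(N + 1) - ln N. *)
Lemma dG_shift (tau : R) (z : C) : 0 < tau ->
  dG tau z = (RGamma (z / tau) * dG tau (z + 1))%C.
Proof.
  intros Ht.
  destruct (psi_defect_cv tau Ht) as [kappa Hk].
  destruct (psi1_defect_cv tau Ht) as [delta Hd].
  rewrite <- (is_Clim_unique _ _ (dG_partial_cv tau z Ht)).
  apply is_Clim_unique.
  apply is_Clim_ext with (fun N => RGamma_seq (z / tau) N * dG_partial tau (z + 1) N *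
    Cexp ((-1) * (psi_defect tau N - kappa)%R + (- (z + / 2)) * (psi1_defect tau N - delta)%R
          + (- (z / tau)) * (ln (INR N + 1) - ln (INR N))%R))%C.
  - intros N. symmetry. unfold dG_partial.
    rewrite (RGamma_S z), cprod_dG_factor_step by auto.
    set (P := cprod (dG_factor _ _) 1 N). set (e1 := Cexp (dG_exponent tau z)).
    set (e2 := Cexp (- _)).
    transitivity (/ tau * RGamma (z + 1) * P * (e1 * e2) * (z * cprod (fun j => z + INR j * tau) 1 N))%C; [ring|].
    rewrite cprod_arith_RGamma_seq by auto.
    set (Q := RGamma_seq _ N). set (e3 := Cexp (_ + _)%C). set (e4 := Cexp (dG_exponent _ _)).
    set (e5 := Cexp (_ + _)%C).
    transitivity (/ tau * RGamma (z + 1) * P * Q * (e1 * e2 * e3))%C; [ring|].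
    transitivity (/ tau * RGamma (z + 1) * P * Q * (e4 * e5))%C; [|ring].
    f_equal. unfold e1, e2, e3, e4, e5. rewrite <- !Cexp_plus. f_equal.
    unfold dG_exponent. rewrite (dG_a_eq tau kappa), (dG_b_eq tau delta) by auto.
    unfold psi_defect, psi1_defect.
    repeat rewrite ?RtoC_plus, ?RtoC_minus, ?RtoC_mult, ?RtoC_opp, ?RtoC_pow, ?RtoC_inv by lra.
    field; apply RtoC_neq_0; lra.
  - replace (RGamma (z / tau) * dG tau (z + 1))%C with
     (RGamma (z / tau) * dG tau (z + 1) * Cexp ((-1) * 0 + (- (z + / 2)) * 0 + (- (z / tau)) * 0))%C.
    2: { rewrite !Cmult_0_r, !Cplus_0_r, Cexp_0; ring. }
    apply is_Clim_mult; [apply is_Clim_mult; [apply RGamma_spec|apply dG_partial_cv; auto]|].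
    apply is_Clim_exp.
    assert (Hz : forall u (l : R), is_lim_seq u l -> is_lim_seq (fun n => u n - l) 0).
    { intros u l Hu. replace (Finite 0) with (Finite (l - l)) by (f_equal; ring).
      apply (is_lim_seq_minus' _ _ _ _); [exact Hu|apply is_lim_seq_const]. }
    apply is_Clim_plus; [apply is_Clim_plus|]; apply is_Clim_mult; try apply is_Clim_const; apply is_Clim_RtoC.
    + apply Hz, Hk. + apply Hz, Hd. + apply ln_succ_lim.
Qed.

Lemma dG_ratio_up (tau : R) (w : C) : 0 < tau -> dG tau w <> 0 ->
  (dG tau (w + 1) / dG tau w = Gamma (w / tau))%C.
Proof.
  intros Ht H. pose proof (dG_shift tau w Ht) as E. unfold Gamma.
  assert (H1 : RGamma (w / tau) <> 0) by (intros H1; apply H; rewrite E, H1; ring).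
  assert (H2 : dG tau (w + 1) <> 0) by (intros H2; apply H; rewrite E, H2; ring).
  rewrite E. field; auto.
Qed.

Lemma dG_ratio_down (tau : R) (w : C) : 0 < tau -> dG tau w <> 0 ->
  (dG tau (w - 1) / dG tau w = / Gamma ((w - 1) / tau))%C.
Proof.
  intros Ht H. unfold Gamma. rewrite Cinv_inv_total, (dG_shift tau (w - 1)) by auto.
  replace (w - 1 + 1)%C with w by ring. field; auto.
Qed.

(** * Scaling a contour *)

Lemma Cdiv_real (w : C) (r : R) : r <> 0 -> (w / r)%C = (Re w / r, Im w / r).
Proof.
  intros H. apply C_eq; unfold Cdiv, Cinv; destruct w; simpl.
  all: field; auto.
Qed.

Lemma Cdiv_real_scal (w : C) (r : R) : r <> 0 -> (w / r)%C = scal (V := C_R_NormedModule) (/ r) w.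
Proof. intros H. rewrite Cdiv_real by auto. change (scal (/ r) w) with (/ r * Re w, / r * Im w).
  apply C_eq; simpl; field; auto. Qed.

Lemma filterlim_Cdiv_real (r : R) (w : C) : r <> 0 ->
  filterlim (fun w : C => (w / r)%C) (locally w) (locally (w / r)%C).
Proof.
  intros H. rewrite Cdiv_real_scal by auto.
  apply (filterlim_ext (fun w : C => scal (V := C_R_NormedModule) (/ r) w)).
  - intros x; symmetry; apply Cdiv_real_scal; auto.
  - apply (filterlim_scal_r (V := C_R_NormedModule) (/ r) w).
Qed.

Lemma path_deriv_scale (r : R) (g : R -> C) (t : R) : r <> 0 ->
  path_deriv (fun u => g u / r)%C t = (path_deriv g t / r)%C.
Proof.
  intros H. rewrite (Cdiv_real (path_deriv g t)) by auto. apply C_eq.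
  - change (Derive (fun u => Re (g u / r)%C) t = Derive (fun u => Re (g u)) t / r).
    rewrite (Derive_ext _ (fun u => / r * Re (g u))).
    + rewrite Derive_scal. unfold Rdiv; ring.
    + intros u. rewrite Cdiv_real by auto. simpl. unfold Rdiv; ring.
  - change (Derive (fun u => Im (g u / r)%C) t = Derive (fun u => Im (g u)) t / r).
    rewrite (Derive_ext _ (fun u => / r * Im (g u))).
    + rewrite Derive_scal. unfold Rdiv; ring.
    + intros u. rewrite Cdiv_real by auto. simpl. unfold Rdiv; ring.
Qed.

Lemma piecewise_C1_scale (r : R) (g : R -> C) : r <> 0 -> piecewise_C1 g ->
  piecewise_C1 (fun t => g t / r)%C.
Proof.
  intros H [Hc [l [Hl1 Hl2]]]. split.
  - intros t. apply (filterlim_comp _ _ _ g (fun w => (w / r)%C) _ (locally (g t))); [apply Hc|].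
    apply filterlim_Cdiv_real; auto.
  - exists l. split.
    + intros t Ht. destruct (Hl1 t Ht) as [H1 [H2 H3]]. repeat split.
      * apply (ex_derive_ext (fun u => / r * Re (g u))).
        -- intros u. rewrite Cdiv_real by auto. simpl. unfold Rdiv; ring.
        -- apply ex_derive_scal; auto.
      * apply (ex_derive_ext (fun u => / r * Im (g u))).
        -- intros u. rewrite Cdiv_real by auto. simpl. unfold Rdiv; ring.
        -- apply ex_derive_scal; auto.
      * unfold continuous. rewrite path_deriv_scale by auto.
        apply (filterlim_ext (fun t => path_deriv g t / r)%C).
        -- intros; symmetry; apply path_deriv_scale; auto.
        -- apply (filterlim_comp _ _ _ (path_deriv g) (fun w => (w / r)%C) _ (locally (path_deriv g t))); [apply H3|].
           apply filterlim_Cdiv_real; auto.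
    + assert (Hf : forall F : (R -> Prop) -> Prop, Filter F ->
        (exists d : C, filterlim (path_deriv g) F (locally d)) ->
        exists d : C, filterlim (path_deriv (fun t => g t / r)%C) F (locally d)).
      { intros F HF [d Hd]. exists (d / r)%C.
        apply (filterlim_ext (fun t => path_deriv g t / r)%C).
        - intros; symmetry; apply path_deriv_scale; auto.
        - apply (filterlim_comp _ _ _ (path_deriv g) (fun w => (w / r)%C) _ (locally d)); [apply Hd|].
           apply filterlim_Cdiv_real; auto. }
      intros t Ht. destruct (Hl2 t Ht) as [H1 H2]. split; apply Hf; auto; typeclasses eauto.
Qed.

Lemma is_lim_scale (r : R) (f h : R -> R) (x e : Rbar) : 0 < r ->
  (forall t, h t = f t / r) -> is_lim f x e -> is_lim h x (Rbar_mult e (/ r)).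
Proof.
  intros Hr Hh Hf. apply (is_lim_ext (fun t => f t * / r)); [intros; symmetry; apply Hh|].
  apply (is_lim_scal_r f (/ r)); auto.
Qed.

Lemma Rbar_mult_pos_infty (e : Rbar) (r : R) : 0 < r -> e = m_infty \/ e = p_infty ->
  Rbar_mult e (/ r) = e.
Proof.
  intros Hr He. assert (H : 0 < / r) by (apply Rinv_0_lt_compat; auto).
  destruct He; subst.
  - apply is_Rbar_mult_unique. apply is_Rbar_mult_m_infty_pos. exact H.
  - apply is_Rbar_mult_unique. apply is_Rbar_mult_p_infty_pos. exact H.
Qed.

Lemma is_loop_scale (r : R) (e : Rbar) (g : R -> C) : 0 < r -> e = m_infty \/ e = p_infty ->
  is_loop e g -> is_loop e (fun t => g t / r)%C.
Proof.
  intros Hr He [f1 [f2 [Hf [H1 [H2 [H3 [H4 [h1 [h2 Hh]]]]]]]]].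
  assert (H : 0 < / r) by (apply Rinv_0_lt_compat; auto).
  assert (Er : forall t, Re (g t / r)%C = Re (g t) / r) by (intros; rewrite Cdiv_real by lra; reflexivity).
  assert (Ei : forall t, Im (g t / r)%C = Im (g t) / r) by (intros; rewrite Cdiv_real by lra; reflexivity).
  exists (f1 * / r), (f2 * / r). split; [split; nra|].
  repeat split.
  - rewrite <- (Rbar_mult_pos_infty e r) by auto. apply (is_lim_scale r (fun t => Re (g t))); auto.
  - apply (is_lim_scale r (fun t => Im (g t)) _ _ (Finite f1)); auto.
  - rewrite <- (Rbar_mult_pos_infty e r) by auto. apply (is_lim_scale r (fun t => Re (g t))); auto.
  - apply (is_lim_scale r (fun t => Im (g t)) _ _ (Finite f2)); auto.
  - exists (h1 * / r), (h2 * / r). intros t. rewrite Ei. unfold Rdiv. specialize (Hh t). split; nra.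
Qed.

Lemma contour_scale (r : R) (k : contour_kind) (g : R -> C) : 0 < r -> contour k g ->
  contour k (fun t => g t / r)%C.
Proof.
  intros Hr [Hg Hk]. split; [apply piecewise_C1_scale; auto; lra|].
  assert (H : 0 < / r) by (apply Rinv_0_lt_compat; auto).
  assert (Er : forall w, Re (w / r)%C = Re w / r) by (intros; rewrite Cdiv_real by lra; reflexivity).
  assert (Ei : forall w, Im (w / r)%C = Im w / r) by (intros; rewrite Cdiv_real by lra; reflexivity).
  destruct k; simpl in *.
  - destruct Hk as [[c Hc] [H1 [H2 H3]]]. split; [|split; [|split]].
    + exists (c / r). intros t. rewrite Er, Hc; auto.
    + intros t u Htu. rewrite !Ei. unfold Rdiv. specialize (H1 t u Htu). nra.
    + rewrite <- (Rbar_mult_pos_infty m_infty r) at 2 by auto.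
      apply (is_lim_scale r (fun t => Im (g t))); auto.
    + rewrite <- (Rbar_mult_pos_infty p_infty r) at 2 by auto.
      apply (is_lim_scale r (fun t => Im (g t))); auto.
  - apply is_loop_scale; auto.
  - apply is_loop_scale; auto.
  - destruct Hk as [t0 [t1 [u [v [H0 [Hu [Hv [H1 H2]]]]]]]].
    assert (Hr0 : RtoC r <> 0) by (apply RtoC_neq_0; lra).
    assert (Hn : forall w : C, w <> 0 -> (w / r)%C <> 0).
    { intros w Hw E. apply Hw. replace w with (w / r * r)%C by (field; auto). rewrite E; ring. }
    exists t0, t1, (u / r)%C, (v / r)%C. repeat split; auto.
    + rewrite (proj1 (H1 t H3)). field; auto.
    + rewrite Ei. unfold Rdiv. destruct (H1 t H3). nra.
    + rewrite (proj1 (H2 t H3)). field; auto.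
    + rewrite Ei. unfold Rdiv. destruct (H2 t H3). nra.
Qed.

Lemma same_side_scale (r : R) (g : R -> C) (w w' : C) : r <> 0 ->
  same_side g (w * r)%C (w' * r)%C -> same_side (fun t => g t / r)%C w w'.
Proof.
  intros Hr [h [Hc [H0 [H1 Hs]]]]. pose proof (RtoC_neq_0 r Hr) as Hr0.
  exists (fun x => h x / r)%C. split; [|split; [|split]].
  - intros x. apply (filterlim_comp _ _ _ h (fun w => (w / r)%C) _ (locally (h x))); [apply Hc|].
    apply filterlim_Cdiv_real; auto.
  - rewrite H0; field; auto.
  - rewrite H1; field; auto.
  - intros x t Hx E. apply (Hs x t Hx).
    replace (h x) with (h x / r * r)%C by (field; auto). rewrite E; field; auto.
Qed.

Lemma left_of_scale (r : R) (g : R -> C) (w : C) : 0 < r ->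
  left_of g (w * r)%C -> left_of (fun t => g t / r)%C w.
Proof.
  intros Hr [M HM]. exists (M / r). intros x Hx. apply same_side_scale; [lra|].
  rewrite <- RtoC_mult. apply HM. apply Rle_div_r in Hx; auto.
Qed.

Lemma right_of_scale (r : R) (g : R -> C) (w : C) : 0 < r ->
  right_of g (w * r)%C -> right_of (fun t => g t / r)%C w.
Proof.
  intros Hr [M HM]. exists (M / r). intros x Hx. apply same_side_scale; [lra|].
  rewrite <- RtoC_mult. apply HM. apply Rle_div_l in Hx; auto.
Qed.

(** A path that leaves a point of the contour meets the contour at its start. *)
Lemma left_of_avoids (g : R -> C) (t : R) : ~ left_of g (g t).
Proof.
  intros [M HM]. destruct (HM M (Rle_refl M)) as [h [_ [H0 [_ Hs]]]].
  apply (Hs 0 t); [lra|auto].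
Qed.

Lemma right_of_avoids (g : R -> C) (t : R) : ~ right_of g (g t).
Proof.
  intros [M HM]. destruct (HM M (Rle_refl M)) as [h [_ [H0 [_ Hs]]]].
  apply (Hs 0 t); [lra|auto].
Qed.

Lemma Cmod_cpow_real (z : C) (theta r : R) : Cmod (cpow_arg z theta r) = exp (r * ln (Cmod z)).
Proof. unfold cpow_arg. rewrite Cmod_Cexp. f_equal. simpl. ring. Qed.

Lemma cpow_arg_real_is_arg (z : C) (theta r : R) : is_arg (cpow_arg z theta r) (r * theta).
Proof.
  unfold is_arg. rewrite Cmod_cpow_real, <- Cexp_RtoC, <- Cexp_plus.
  unfold cpow_arg. f_equal. rewrite !RtoC_mult. ring.
Qed.

Lemma cpow_arg_scale (z : C) (theta r : R) (s : C) : r <> 0 ->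
  cpow_arg (cpow_arg z theta r) (r * theta) (- (s / r))%C = cpow_arg z theta (- s)%C.
Proof.
  intros Hr. unfold cpow_arg at 1. rewrite Cmod_cpow_real, ln_exp.
  unfold cpow_arg. f_equal. rewrite !RtoC_mult. field. apply RtoC_neq_0; auto.
Qed.

(** The substitution s -> s/r for parametrised paths: the derivative of the
    path is divided by r. *)
Lemma contour_int_scale (f h : C -> C) (g : R -> C) (r : R) : r <> 0 ->
  (forall t, f (g t) = h (g t / r)%C) -> contour_converges f g ->
  contour_converges h (fun t => g t / r)%C /\
  contour_int f g = (r * contour_int h (fun t => g t / r))%C.
Proof.
  intros Hr Hfh Hf.
  assert (E : forall t, (pullback f g t / r)%C = pullback h (fun t => g t / r)%C t).
  { intros t. unfold pullback. rewrite path_deriv_scale, <- Hfh by auto.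
    field. apply RtoC_neq_0; auto. }
  assert (I : is_RInt_gen (V := C_R_NormedModule) (pullback f g)
      (Rbar_locally m_infty) (Rbar_locally p_infty) (contour_int f g)).
  { apply (RInt_gen_correct (V := C_R_CompleteNormedModule)). exact Hf. }
  assert (I' : is_RInt_gen (V := C_R_NormedModule) (pullback h (fun t => g t / r)%C)
      (Rbar_locally m_infty) (Rbar_locally p_infty) (contour_int f g / r)%C).
  { rewrite Cdiv_real_scal by auto.
    apply (is_RInt_gen_ext (fun t => scal (V := C_R_NormedModule) (/ r) (pullback f g t))).
    - apply filter_forall. intros ab x _. rewrite <- Cdiv_real_scal by auto. apply E.
    - apply (is_RInt_gen_scal (V := C_R_NormedModule)); exact I. }
  split; [exists (contour_int f g / r)%C; exact I'|].
  apply (is_RInt_gen_unique (V := C_R_CompleteNormedModule)) in I'.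
  unfold contour_int at 2. rewrite I'. field. apply RtoC_neq_0; auto.
Qed.

(** * Fox integrands and the reduction *)

Lemma cprod_div (f h : nat -> C) (lo hi : nat) :
  (cprod f lo hi / cprod h lo hi = cprod (fun k => f k / h k) lo hi)%C.
Proof. unfold Cdiv. rewrite cprod_inv, <- cprod_mult. reflexivity. Qed.

(** Applied twice: to the factors in b_i with those in a_(n+i), and to those
    in a_i with those in b_(m+i). *)
Lemma dG_quotients (tau : R) (u v : nat -> C) (N N0 : nat) : 0 < tau -> (N0 <= N)%nat ->
  (forall i, (1 <= i <= N)%nat -> dG tau (v i) <> 0) ->
  (forall i, (1 <= i <= N0)%nat -> u i = (v i + 1)%C) ->
  (forall i, (N0 + 1 <= i <= N)%nat -> u i = (v i - 1)%C) ->
  (cprod (fun i => dG tau (u i)) 1 N / cprod (fun i => dG tau (v i)) 1 N =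
   cprod (fun i => Gamma (v i / tau)) 1 N0
   / cprod (fun i => Gamma ((v (N0 + i)%nat - 1) / tau)) 1 (N - N0))%C.
Proof.
  intros Ht HN Hv Hu1 Hu2.
  rewrite cprod_div, (cprod_split _ 1 N0 N) by lia.
  unfold Cdiv at 3. rewrite cprod_inv. f_equal.
  - apply cprod_ext. intros i Hi. rewrite Hu1 by lia. apply dG_ratio_up; auto. apply Hv; lia.
  - replace (S N0) with (N0 + 1)%nat by lia. replace N with (N0 + (N - N0))%nat at 1 by lia.
    rewrite cprod_shift. apply cprod_ext. intros i Hi.
    rewrite Hu2 by lia. apply dG_ratio_down; auto. apply Hv; lia.
Qed.

Theorem proposition1
  (tau : R) (m n p q m0 n0 : nat)
  (a b : nat -> C) (alpha beta : nat -> R)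
  (z : C) (theta : R) (k : contour_kind) (g : R -> C)
  (Hp : p = (m + n)%nat) (Hq : q = (m + n)%nat)
  (Halpha : forall i : nat, (1 <= i <= n)%nat -> alpha i = beta (m + i)%nat)
  (Hbeta : forall i : nat, (1 <= i <= m)%nat -> beta i = alpha (n + i)%nat)
  (Hm0 : (1 <= m0 <= m)%nat) (Hn0 : (1 <= n0 <= n)%nat)
  (Ha1 : forall i : nat, (1 <= i <= n0)%nat -> a i = (b (m + i)%nat - 1)%C)
  (Ha2 : forall i : nat, (n0 + 1 <= i <= n)%nat -> a i = (b (m + i)%nat + 1)%C)
  (Hb1 : forall i : nat, (1 <= i <= m0)%nat -> b i = (a (n + i)%nat + 1)%C)
  (Hb2 : forall i : nat, (m0 + 1 <= i <= m)%nat -> b i = (a (n + i)%nat - 1)%C)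
  (HJ : foxJ_defined tau 0 m n p q a alpha b beta z theta k g) :
  let p0 := (n0 + m - m0)%nat in
  let q0 := (m0 + n - n0)%nat in
  let at_ := fun i : nat =>
    if Nat.leb i n0 then (a i / tau)%C
    else ((a (n - n0 + m0 + i)%nat - 1) / tau)%C in
  let bt := fun i : nat =>
    if Nat.leb i m0 then ((b i - 1) / tau)%C
    else (b (m - m0 + n0 + i)%nat / tau)%C in
  let alphat := fun i : nat =>
    if Nat.leb i n0 then alpha i else alpha (n - n0 + m0 + i)%nat in
  let betat := fun i : nat =>
    if Nat.leb i m0 then beta i else beta (m - m0 + n0 + i)%nat in
  let ztau := cpow_arg z theta tau in
  let gH := fun t : R => (g t / tau)%C in
  foxH_defined m0 n0 p0 q0 at_ alphat bt betat ztau (tau * theta) k gH /\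
  foxJ tau 0 m n p q a alpha b beta z theta g
  = (tau * foxH m0 n0 p0 q0 at_ alphat bt betat ztau (tau * theta) gH)%C.
Proof.
  intros p0 q0 at_ bt alphat betat ztau gH.
  destruct HJ as [_ _ Ht Hap Hbp _ _ Hz Harg Hg [HL HR] Hconv].
  assert (Hr : tau <> 0) by lra. pose proof (RtoC_neq_0 tau Hr) as HrC.
  (* The arguments of the Gamma factors of H at s/tau, in terms of the arguments
     of the G factors in the denominator of J at s. *)
  assert (Ebt1 : forall i s, (1 <= i <= m0)%nat ->
    (bt i + betat i * (s / tau))%C = ((a (n + i)%nat + alpha (n + i)%nat * s) / tau)%C).
  { intros i s Hi. unfold bt, betat. rewrite (proj2 (Nat.leb_le i m0)) by lia.
    rewrite Hb1, Hbeta by lia. field; auto. }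
  assert (Eat1 : forall i s, (1 <= i <= n0)%nat ->
    (1 - at_ i - alphat i * (s / tau))%C
      = ((1 + tau - b (m + i)%nat - beta (m + i)%nat * s) / tau)%C).
  { intros i s Hi. unfold at_, alphat. rewrite (proj2 (Nat.leb_le i n0)) by lia.
    rewrite Ha1, Halpha by lia. field; auto. }
  assert (Ebt2 : forall i s, (1 <= i <= n - n0)%nat ->
    (1 - bt (m0 + i)%nat - betat (m0 + i)%nat * (s / tau))%C
      = ((1 + tau - b (m + (n0 + i))%nat - beta (m + (n0 + i))%nat * s - 1) / tau)%C).
  { intros i s Hi. unfold bt, betat. rewrite (proj2 (Nat.leb_gt (m0 + i) m0)) by lia.
    replace (m - m0 + n0 + (m0 + i))%nat with (m + (n0 + i))%nat by lia. field; auto. }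
  assert (Eat2 : forall i s, (1 <= i <= m - m0)%nat ->
    (at_ (n0 + i)%nat + alphat (n0 + i)%nat * (s / tau))%C
      = ((a (n + (m0 + i))%nat + alpha (n + (m0 + i))%nat * s - 1) / tau)%C).
  { intros i s Hi. unfold at_, alphat. rewrite (proj2 (Nat.leb_gt (n0 + i) n0)) by lia.
    replace (n - n0 + m0 + (n0 + i))%nat with (n + (m0 + i))%nat by lia. field; auto. }
  assert (Hscale : forall s, (s * tau / tau)%C = s) by (intros s; field; auto).
  assert (Hint : forall t, J_full_integrand tau 0 m n p q a alpha b beta z theta (g t)
     = H_integrand m0 n0 p0 q0 at_ alphat bt betat ztau (tau * theta) (g t / tau)).
  { intros t. set (s := g t).
    assert (NL : forall i, (1 <= i <= m)%nat -> dG tau (a (n + i)%nat + alpha (n + i)%nat * s) <> 0).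
    { intros i Hi E. apply (left_of_avoids g t), HL. exists (n + i)%nat. split; [lia|exact E]. }
    assert (NR : forall i, (1 <= i <= n)%nat -> dG tau (1 + tau - b (m + i)%nat - beta (m + i)%nat * s) <> 0).
    { intros i Hi E. apply (right_of_avoids g t), HR. exists (m + i)%nat. split; [lia|exact E]. }
    unfold J_full_integrand, H_integrand. unfold ztau. rewrite cpow_arg_scale by auto.
    replace (PI * 0 * s ^ 2 / tau)%C with (RtoC 0) by (field; auto).
    rewrite Cexp_0, Cmult_1_r. f_equal.
    pose proof (dG_quotients tau (fun i => b i + beta i * s)%C
      (fun i => a (n + i)%nat + alpha (n + i)%nat * s)%C m m0 Ht (proj2 Hm0) NL) as Q1.
    pose proof (dG_quotients tau (fun i => 1 + tau - a i - alpha i * s)%C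
      (fun i => 1 + tau - b (m + i)%nat - beta (m + i)%nat * s)%C n n0 Ht (proj2 Hn0) NR) as Q2.
    cbv beta in Q1, Q2.
    assert (Q1' := Q1 ltac:(intros i Hi; rewrite Hb1, Hbeta by lia; ring)
                      ltac:(intros i Hi; rewrite Hb2, Hbeta by lia; ring)).
    assert (Q2' := Q2 ltac:(intros i Hi; rewrite Ha1, Halpha by lia; ring)
                      ltac:(intros i Hi; rewrite Ha2, Halpha by lia; ring)).
    clear Q1 Q2. unfold J_integrand. subst p q.
    rewrite (Nat.add_comm m n) at 2. rewrite !cprod_shift.
    unfold p0, q0. replace (n0 + m - m0)%nat with (n0 + (m - m0))%nat by lia.
    replace (m0 + n - n0)%nat with (m0 + (n - n0))%nat by lia. rewrite !cprod_shift.
    rewrite (cprod_ext (fun i => Gamma (bt i + betat i * (s / tau)))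
      (fun i => Gamma ((a (n + i)%nat + alpha (n + i)%nat * s) / tau)))
      by (intros; rewrite Ebt1 by lia; reflexivity).
    rewrite (cprod_ext (fun i => Gamma (1 - at_ i - alphat i * (s / tau)))
      (fun i => Gamma ((1 + tau - b (m + i)%nat - beta (m + i)%nat * s) / tau)))
      by (intros; rewrite Eat1 by lia; reflexivity).
    rewrite (cprod_ext (fun i => Gamma (1 - bt (m0 + i)%nat - betat (m0 + i)%nat * (s / tau)))
      (fun i => Gamma ((1 + tau - b (m + (n0 + i))%nat - beta (m + (n0 + i))%nat * s - 1) / tau)))
      by (intros; rewrite Ebt2 by lia; reflexivity).
    rewrite (cprod_ext (fun i => Gamma (at_ (n0 + i)%nat + alphat (n0 + i)%nat * (s / tau)))
      (fun i => Gamma ((a (n + (m0 + i))%nat + alpha (n + (m0 + i))%nat * s - 1) / tau)))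
      by (intros; rewrite Eat2 by lia; reflexivity).
    assert (Hre : forall A1 A2 A3 A4 : C, (A1 * A2 / (A3 * A4) = (A1 / A4) * (A2 / A3))%C).
    { intros; unfold Cdiv; rewrite Cinv_mult_total; ring. }
    rewrite !Hre, Q1', Q2'. reflexivity. }
  destruct (contour_int_scale _ _ g tau Hr Hint Hconv) as [HcH HiH].
  split.
  - constructor.
    + unfold q0; lia.
    + unfold p0; lia.
    + intros i Hi. unfold alphat. destruct (Nat.leb_spec i n0); apply Hap; unfold p0 in *; lia.
    + intros i Hi. unfold betat. destruct (Nat.leb_spec i m0); apply Hbp; unfold q0 in *; lia.
    + apply Cexp_neq_0.
    + apply cpow_arg_real_is_arg.
    + apply contour_scale; auto.
    + split.
      * intros s [i [Hi E]]. apply left_of_scale; auto. apply HL.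
        exists (n + i)%nat. split; [lia|].
        rewrite <- (Hscale s), Ebt1 in E by auto.
        rewrite dG_shift, E by auto; ring.
      * intros s [i [Hi E]]. apply right_of_scale; auto. apply HR.
        exists (m + i)%nat. split; [lia|].
        rewrite <- (Hscale s), Eat1 in E by auto.
        rewrite dG_shift, E by auto; ring.
    + exact HcH.
  - unfold foxJ, foxH. rewrite HiH. set (I := contour_int _ _). set (c := (/ _)%C).
    ring.
Qed.
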